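(* Let $n,k$ be positive integers, $T$ a UCPT$(n)$-Schur multiplier and $S$ a UCPT$(k)$-Schur multiplier. Then $$d_{\mathrm{cb}}\big(T\otimes S,\mathrm{conv}(\mathrm{Aut}(M_{nk}(\mathbb{C})))\big)\geq \tfrac12\, d_{\mathrm{cb}}\big(T,\mathrm{conv}(\mathrm{Aut}(M_n(\mathbb{C})))\big).$$ In particular, if $T\notin\mathrm{conv}(\mathrm{Aut}(M_n(\mathbb{C})))$, then $T$ fails the asymptotic quantum Birkhoff property.
   Context: A UCPT$(n)$-map is a unital completely positive trace-preserving linear map on $M_n(\mathbb{C})$. A UCPT$(n)$-Schur multiplier is a UCPT$(n)$-map of the form $x=(x_{ij})\mapsto(b_{ij}x_{ij})$ for a fixed matrix $(b_{ij})$. $\mathrm{Aut}(M_m(\mathbb{C}))$ is the set of maps $x\mapsto u^*xu$ with $u$ unitary, $\mathrm{conv}$ denotes convex hull, $M_n(\mathbb{C})\otimes M_k(\mathbb{C})$ is identified with $M_{nk}(\mathbb{C})$, and $d_{\mathrm{cb}}(T,\mathcal{C})=\inf_{R\in\mathcal{C}}\|T-R\|_{\mathrm{cb}}$. A UCPT$(n)$-map $T$ satisfies the asymptotic quantum Birkhoff property if $\lim_{k\to\infty} d_{\mathrm{cb}}\big(T^{\otimes k},\mathrm{conv}(\mathrm{Aut}(M_{n^k}(\mathbb{C})))\big)=0$. *)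

(* Defs.v *)
From HB Require Import structures.
From mathcomp Require Import all_boot all_order all_algebra.
From mathcomp Require Import complex mxtens.
From mathcomp Require Import boolp classical_sets reals topology normedtype sequences.
Set Implicit Arguments. Unset Strict Implicit. Unset Printing Implicit Defensive.
Import Order.TTheory GRing.Theory Num.Theory numFieldNormedType.Exports.
Local Open Scope ring_scope.
Local Open Scope classical_set_scope.

Section QDefs.
Variable R : realType.
Local Notation C := (R[i]).

Definition adjmx m n (A : 'M[C]_(m, n)) : 'M[C]_(n, m) := (map_mx (@conjc R) A)^T.

Definition vnorm n (v : 'cV[C]_n) : R := Num.sqrt (\sum_i (complex.Re (v i 0) ^+ 2 + complex.Im (v i 0) ^+ 2)).

Definition opnorm m n (A : 'M[C]_(m, n)) : R :=
  sup [set vnorm (A *m v) | v in [set v : 'cV[C]_n | vnorm v <= 1]].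

Definition mapnorm n (Phi : 'M[C]_n -> 'M[C]_n) : R :=
  sup [set opnorm (Phi X) | X in [set X : 'M[C]_n | opnorm X <= 1]].

(* tensor product T (x) S of maps, on M_n (x) M_k = M_(n*k) (Kronecker identification,
   as in mxtens: index (i,p) |-> i*k + p) *)
Definition tens n k (T : 'M[C]_n -> 'M[C]_n) (S : 'M[C]_k -> 'M[C]_k)
  (X : 'M[C]_(n * k)) : 'M[C]_(n * k) :=
  \sum_(i < n) \sum_(j < n) \sum_(p < k) \sum_(q < k)
     X (mxtens_index (i, p)) (mxtens_index (j, q)) *:
       (T (delta_mx i j) *t S (delta_mx p q)).

Definition ampl m n (Phi : 'M[C]_n -> 'M[C]_n) : 'M[C]_(m * n) -> 'M[C]_(m * n) :=
  tens (fun X : 'M[C]_m => X) Phi.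
Arguments ampl m {n} Phi _.

Definition cbnorm n (Phi : 'M[C]_n -> 'M[C]_n) : R :=
  sup [set x | exists m : nat, x = mapnorm (ampl m Phi)].

Definition dcb n (T : 'M[C]_n -> 'M[C]_n) (Cset : set ('M[C]_n -> 'M[C]_n)) : R :=
  inf [set cbnorm (fun X => T X - Phi X) | Phi in Cset].

Definition unitary n (u : 'M[C]_n) : Prop :=
  u *m adjmx u = 1%:M /\ adjmx u *m u = 1%:M.

Definition Aut n : set ('M[C]_n -> 'M[C]_n) :=
  [set Phi | exists u : 'M[C]_n, unitary u /\ Phi = (fun x => adjmx u *m x *m u)].

Definition convAut n : set ('M[C]_n -> 'M[C]_n) :=
  [set Phi | exists (l : nat) (lam : 'I_l -> R) (Ph : 'I_l -> 'M[C]_n -> 'M[C]_n),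
     (forall i, 0 <= lam i) /\ \sum_i lam i = 1 /\ (forall i, Aut (Ph i)) /\
     Phi = (fun x => \sum_i (lam i)%:C%C *: Ph i x)].

Definition is_linear_map n (T : 'M[C]_n -> 'M[C]_n) : Prop :=
  forall (a : C) (x y : 'M[C]_n), T (a *: x + y) = a *: T x + T y.

Definition psd n (A : 'M[C]_n) : Prop :=
  forall v : 'cV[C]_n, 0 <= (adjmx v *m A *m v) 0 0.

Definition completely_positive n (T : 'M[C]_n -> 'M[C]_n) : Prop :=
  forall (m : nat) (X : 'M[C]_(m * n)), psd X -> psd (ampl m T X).

Definition UCPT n (T : 'M[C]_n -> 'M[C]_n) : Prop :=
  [/\ is_linear_map T, T 1%:M = 1%:M, completely_positive T &
      forall x, \tr (T x) = \tr x].

Definition UCPT_Schur n (T : 'M[C]_n -> 'M[C]_n) : Prop :=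
  UCPT T /\ exists b : 'M[C]_n, forall x, T x = \matrix_(i, j) (b i j * x i j).

Fixpoint tpow n (T : 'M[C]_n -> 'M[C]_n) (k : nat) : 'M[C]_(n ^ k) -> 'M[C]_(n ^ k) :=
  match k return 'M[C]_(n ^ k) -> 'M[C]_(n ^ k) with
  | 0 => fun X => X
  | k'.+1 => fun X =>
      castmx (esym (expnS n k'), esym (expnS n k'))
        (tens T (@tpow n T k') (castmx (expnS n k', expnS n k') X))
  end.
Arguments tpow {n} T k _.

Definition AQBP n (T : 'M[C]_n -> 'M[C]_n) : Prop :=
  (fun k : nat => dcb (tpow T k) (@convAut (n ^ k))) @ \oo --> (0 : R).

End QDefs.

(* Main.v *)
Require Import Defs.
From HB Require Import structures.
From mathcomp Require Import all_boot all_order all_algebra.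
From mathcomp Require Import complex mxtens.
From mathcomp Require Import boolp classical_sets reals topology normedtype sequences.
From mathcomp Require Import ring lra.
Set Implicit Arguments. Unset Strict Implicit. Unset Printing Implicit Defensive.
Import Order.TTheory GRing.Theory Num.Theory numFieldNormedType.Exports.
Local Open Scope ring_scope.
Local Open Scope classical_set_scope.

(* Let [Phi = sum lam_i Ad(u_i)]. Compressing [T (x) S - Phi] to the corner [M_n (x) e_pp], which
   [S] fixes, shows that [T] is within [delta = ||T (x) S - Phi||_cb] of [sum lam_i Ad(v_i)], where
   the [v_i] are the compressions of the [u_i]. Averages of two unitaries being exactly the
   contractions, [v_i = (w_i + w'_i) / 2], and [(Ad(w_i) + Ad(w'_i)) / 2 - Ad(v_i) = Ad(d_i)] with
   [d_i = (w_i - w'_i) / 2]. The completely positive map [sum lam_i Ad(d_i)] has cb-norm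
   [||1 - sum lam_i v_i^* v_i||], which is at most [delta] by evaluating the first estimate at [1].
   So [T] is within [2 delta] of a convex combination of automorphisms. For the second claim,
   [convAut] is closed: by Caratheodory it is the continuous image of a compact set. *)

(** * Euclidean and operator norms of complex matrices *)

Section Norms.
Context {R : realType}.
Local Notation C := (R[i]).

(** The obstacle is that the compressions [v_i] are in general not unitary, so [sum lam_i Ad(v_i)]
    need be neither unital nor a mixture of automorphisms. The correction by [Ad(d_i)] is affordable
    because it is completely positive: its norm is read off at 1, where [T(1) = 1] ties it to the
    error [delta] already known. The factor 2 counts these two occurrences of [delta]. [S] fixes
    [e_pp] because unitality forces the diagonal of its symbol to be 1. A tensor power of [T] also
    fixes a diagonal matrix unit, so the bound applies to [tens T (tpow T k)] for every [k] and
    keeps the distances away from 0 once [convAut] is known to be closed. On the formal side all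
    norms are suprema in [R], which are meaningful only for bounded sets. Each inequality of the
    form [value <= norm] therefore rests on a boundedness proof, which for [cbnorm] has to be
    uniform in the level of amplification. *)

Lemma adjmxM m n p (A : 'M[C]_(m, n)) (B : 'M[C]_(n, p)) :
  adjmx (A *m B) = adjmx B *m adjmx A.
Proof. by rewrite /adjmx map_mxM trmx_mul. Qed.

Lemma adjmxK m n (A : 'M[C]_(m, n)) : adjmx (adjmx A) = A.
Proof. by apply/matrixP=> i j; rewrite !mxE conjcK. Qed.

Lemma adjmxD m n (A B : 'M[C]_(m, n)) : adjmx (A + B) = adjmx A + adjmx B.
Proof. by apply/matrixP=> i j; rewrite !mxE rmorphD. Qed.

Lemma adjmxB m n (A B : 'M[C]_(m, n)) : adjmx (A - B) = adjmx A - adjmx B.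
Proof. by apply/matrixP=> i j; rewrite !mxE rmorphB. Qed.

Lemma adjmxZ m n (r : R) (A : 'M[C]_(m, n)) :
  adjmx (r%:C%C *: A) = r%:C%C *: adjmx A.
Proof. by apply/matrixP=> i j; rewrite !mxE rmorphM /= oppr0. Qed.

Lemma adjmx1 n : adjmx (1%:M : 'M[C]_n) = 1%:M.
Proof. by apply/matrixP=> i j; rewrite !mxE rmorph_nat eq_sym. Qed.

Lemma adjmx_tens m n p q (A : 'M[C]_(m, n)) (B : 'M[C]_(p, q)) :
  adjmx (A *t B) = adjmx A *t adjmx B.
Proof. by rewrite /adjmx map_mxT trmx_tens. Qed.

(* The real inner product of C^n, seen as R^(2n). *)
Definition rdot n (u v : 'cV[C]_n) : R := complex.Re ((adjmx u *m v) 0 0).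

Lemma rdotE n (u v : 'cV[C]_n) : rdot u v =
  \sum_i (complex.Re (u i 0) * complex.Re (v i 0)
          + complex.Im (u i 0) * complex.Im (v i 0)).
Proof.
rewrite /rdot mxE raddf_sum; apply: eq_bigr => i _; rewrite !mxE.
by case: (u i 0) (v i 0) => a b [c d] /=; ring.
Qed.

Lemma rdotC n (u v : 'cV[C]_n) : rdot u v = rdot v u.
Proof. by rewrite !rdotE; apply: eq_bigr => i _; ring. Qed.

Lemma rdotDr n (u v w : 'cV[C]_n) : rdot u (v + w) = rdot u v + rdot u w.
Proof. by rewrite /rdot mulmxDr mxE raddfD. Qed.

Lemma rdotDl n (u v w : 'cV[C]_n) : rdot (v + w) u = rdot v u + rdot w u.
Proof. by rewrite rdotC rdotDr !(rdotC u). Qed.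

Lemma rdotNr n (u v : 'cV[C]_n) : rdot u (- v) = - rdot u v.
Proof. by rewrite /rdot mulmxN mxE raddfN. Qed.

Lemma rdotZr n (r : R) (u v : 'cV[C]_n) : rdot u (r%:C%C *: v) = r * rdot u v.
Proof.
rewrite /rdot -scalemxAr mxE.
by case: ((adjmx u *m v) 0 0) => a b /=; ring.
Qed.

Lemma rdotZl n (r : R) (u v : 'cV[C]_n) : rdot (r%:C%C *: u) v = r * rdot u v.
Proof. by rewrite rdotC rdotZr rdotC. Qed.

Lemma rdot_sumr n (I : finType) (u : 'cV[C]_n) (v : I -> 'cV[C]_n) :
  rdot u (\sum_i v i) = \sum_i rdot u (v i).
Proof. by rewrite /rdot mulmx_sumr summxE raddf_sum. Qed.

Lemma rdot_adj m n (A : 'M[C]_(m, n)) u v : rdot (A *m u) v = rdot u (adjmx A *m v).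
Proof. by rewrite /rdot adjmxM mulmxA. Qed.

Lemma vnormE n (v : 'cV[C]_n) : vnorm v = Num.sqrt (rdot v v).
Proof. by rewrite rdotE. Qed.

Lemma rdot_ge0 n (v : 'cV[C]_n) : 0 <= rdot v v.
Proof. by rewrite rdotE; apply: sumr_ge0 => i _; rewrite -!expr2 addr_ge0 ?sqr_ge0. Qed.

Lemma vnorm_ge0 n (v : 'cV[C]_n) : 0 <= vnorm v.
Proof. exact: sqrtr_ge0. Qed.

Lemma sqr_vnorm n (v : 'cV[C]_n) : vnorm v ^+ 2 = rdot v v.
Proof. by rewrite vnormE sqr_sqrtr ?rdot_ge0. Qed.

Lemma vnormZ n (r : R) (v : 'cV[C]_n) : 0 <= r -> vnorm (r%:C%C *: v) = r * vnorm v.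
Proof.
move=> r0; rewrite !vnormE rdotZl rdotZr mulrA -expr2 sqrtrM ?sqr_ge0 //.
by rewrite sqrtr_sqr ger0_norm.
Qed.

Lemma vnorm0 n : vnorm (0 : 'cV[C]_n) = 0.
Proof. by rewrite vnormE /rdot mulmx0 mxE sqrtr0. Qed.

Lemma vnorm_eq0 n (v : 'cV[C]_n) : vnorm v = 0 -> v = 0.
Proof.
move=> /(congr1 (fun x => x ^+ 2)); rewrite sqr_vnorm expr0n /= rdotE => /psumr_eq0P H.
apply/colP => i; rewrite mxE.
have /eqP := H (fun i _ => addr_ge0 (sqr_ge0 _) (sqr_ge0 _)) i isT.
rewrite -!expr2 paddr_eq0 ?sqr_ge0 // !sqrf_eq0.
by case: (v i 0) => a b /= /andP[/eqP-> /eqP->].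
Qed.

Lemma rdot_AMGM n (u v : 'cV[C]_n) : rdot u v *+ 2 <= rdot u u + rdot v v.
Proof.
have := rdot_ge0 (u - v); rewrite rdotDr !rdotDl !rdotNr !(rdotC (- v)) !rdotNr.
by rewrite opprK mulr2n; lra.
Qed.

Lemma rdot_le n (u v : 'cV[C]_n) : rdot u v <= vnorm u * vnorm v.
Proof.
have [/vnorm_eq0->|u0] := eqVneq (vnorm u) 0.
  by rewrite rdotC /rdot mulmx0 mxE vnorm0 mul0r.
have [/vnorm_eq0->|v0] := eqVneq (vnorm v) 0.
  by rewrite /rdot mulmx0 mxE vnorm0 mulr0.
have pu : 0 < vnorm u by rewrite lt_def u0 vnorm_ge0.
have pv : 0 < vnorm v by rewrite lt_def v0 vnorm_ge0.
(* Cross-scaling gives both vectors the length [vnorm u * vnorm v], where AM-GM becomes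
   Cauchy-Schwarz. *)
have := rdot_AMGM ((vnorm v)%:C%C *: u) ((vnorm u)%:C%C *: v).
rewrite !rdotZl !rdotZr -!sqr_vnorm => H.
rewrite -(ler_pM2l (mulr_gt0 pu pv)); lra.
Qed.

Lemma vnormD n (u v : 'cV[C]_n) : vnorm (u + v) <= vnorm u + vnorm v.
Proof.
rewrite -(@ler_pXn2r _ 2) ?nnegrE ?addr_ge0 ?vnorm_ge0 //.
rewrite sqr_vnorm sqrrD !sqr_vnorm rdotDr !rdotDl (rdotC v u).
have := rdot_le u v; lra.
Qed.

Lemma vnorm_sum n (I : Type) (r : seq I) P (v : I -> 'cV[C]_n) :
  vnorm (\sum_(i <- r | P i) v i) <= \sum_(i <- r | P i) vnorm (v i).
Proof.
elim/big_ind2: _ => [|a b c d h1 h2|//]; first by rewrite vnorm0.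
by rewrite (le_trans (vnormD _ _)) ?lerD.
Qed.

Lemma vnorm_scale n (c : C) (v : 'cV[C]_n) :
  vnorm (c *: v) = Num.sqrt (complex.Re c ^+ 2 + complex.Im c ^+ 2) * vnorm v.
Proof.
rewrite !vnormE -sqrtrM ?addr_ge0 ?sqr_ge0 //; congr Num.sqrt.
rewrite !rdotE mulr_sumr; apply: eq_bigr => i _; rewrite mxE.
by case: c (v i 0) => a b [x y] /=; ring.
Qed.

Lemma entry_le_vnorm n (v : 'cV[C]_n) i :
  Num.sqrt (complex.Re (v i 0) ^+ 2 + complex.Im (v i 0) ^+ 2) <= vnorm v.
Proof.
rewrite ler_sqrt ?sumr_ge0 // => [|j _]; last by rewrite addr_ge0 ?sqr_ge0.
by rewrite (bigD1 i) //= lerDl sumr_ge0 // => j _; rewrite addr_ge0 ?sqr_ge0.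
Qed.

(** A crude bound, whose purpose is to make the supremum defining [opnorm] a genuine one. *)
Lemma mulmx_vnorm_bound m n (A : 'M[C]_(m, n)) (v : 'cV[C]_n) : vnorm v <= 1 ->
  vnorm (A *m v) <= \sum_j vnorm (col j A).
Proof.
move=> v1.
have -> : A *m v = \sum_j v j 0 *: col j A.
  apply/colP => i; rewrite mxE summxE; apply: eq_bigr => j _.
  by rewrite !mxE mulrC.
apply: le_trans (vnorm_sum _ _ _) _; apply: ler_sum => j _; rewrite vnorm_scale.
by rewrite -[leRHS]mul1r ler_wpM2r ?vnorm_ge0 // (le_trans (entry_le_vnorm _ _)).
Qed.

Lemma vnorm_mul_le m n (A : 'M[C]_(m, n)) v : vnorm (A *m v) <= opnorm A * vnorm v.
Proof.
have H w : vnorm w <= 1 -> vnorm (A *m w) <= opnorm A.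
  move=> w1; apply: ub_le_sup; last by exists w.
  exists (\sum_j vnorm (col j A)) => _ [u u1 <-]; exact: mulmx_vnorm_bound.
have [/vnorm_eq0->|v0] := eqVneq (vnorm v) 0.
  by rewrite mulmx0 !vnorm0 mulr0.
have pv : 0 < vnorm v by rewrite lt_def v0 vnorm_ge0.
have := H ((vnorm v)^-1%:C%C *: v).
rewrite -scalemxAr !vnormZ ?invr_ge0 ?vnorm_ge0 // mulVf // lexx => /(_ isT).
by rewrite ler_pdivrMl // mulrC.
Qed.

Lemma opnorm_le m n (A : 'M[C]_(m, n)) c :
  (forall v, vnorm v <= 1 -> vnorm (A *m v) <= c) -> opnorm A <= c.
Proof.
move=> H; apply: ge_sup => [|_ [v v1 <-]]; last exact: H.
by exists (vnorm (A *m 0)); exists 0 => //=; rewrite vnorm0.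
Qed.

Lemma opnorm_ge0 m n (A : 'M[C]_(m, n)) : 0 <= opnorm A.
Proof.
apply: ub_le_sup; last first.
  by exists 0; rewrite /= ?mulmx0 vnorm0.
exists (\sum_j vnorm (col j A)) => _ [u u1 <-]; exact: mulmx_vnorm_bound.
Qed.

Lemma vnorm_mul_le1 m n (A : 'M[C]_(m, n)) v : vnorm v <= 1 -> vnorm (A *m v) <= opnorm A.
Proof.
move=> v1; apply: le_trans (vnorm_mul_le _ _) _.
by rewrite -[leRHS]mulr1 ler_wpM2l ?opnorm_ge0.
Qed.

Lemma opnorm0 m n : opnorm (0 : 'M[C]_(m, n)) = 0.
Proof.
apply/le_anti; rewrite opnorm_ge0 andbT; apply: opnorm_le => v _.
by rewrite mul0mx vnorm0.
Qed.

Lemma opnormD m n (A B : 'M[C]_(m, n)) : opnorm (A + B) <= opnorm A + opnorm B.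
Proof.
apply: opnorm_le => v v1; rewrite mulmxDl (le_trans (vnormD _ _)) //.
by rewrite lerD ?vnorm_mul_le1.
Qed.

Lemma vnormN n (v : 'cV[C]_n) : vnorm (- v) = vnorm v.
Proof. by rewrite !vnormE rdotNr rdotC rdotNr opprK. Qed.

Lemma opnormN m n (A : 'M[C]_(m, n)) : opnorm (- A) = opnorm A.
Proof.
apply/le_anti/andP; split; apply: opnorm_le => v v1.
  by rewrite mulNmx vnormN vnorm_mul_le1.
by rewrite -vnormN -mulNmx vnorm_mul_le1.
Qed.

Lemma opnormM m n p (A : 'M[C]_(m, n)) (B : 'M[C]_(n, p)) :
  opnorm (A *m B) <= opnorm A * opnorm B.
Proof.
apply: opnorm_le => v v1; rewrite -mulmxA (le_trans (vnorm_mul_le _ _)) //.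
by rewrite ler_wpM2l ?opnorm_ge0 ?vnorm_mul_le1.
Qed.

Lemma opnorm_mul_le1 m n p (A : 'M[C]_(m, n)) (B : 'M[C]_(n, p)) :
  opnorm A <= 1 -> opnorm B <= 1 -> opnorm (A *m B) <= 1.
Proof.
by move=> A1 B1; apply: le_trans (opnormM _ _) (mulr_ile1 (opnorm_ge0 _) (opnorm_ge0 _) A1 B1).
Qed.

Lemma opnorm_sum m n (I : Type) (r : seq I) P (A : I -> 'M[C]_(m, n)) :
  opnorm (\sum_(i <- r | P i) A i) <= \sum_(i <- r | P i) opnorm (A i).
Proof.
elim/big_ind2: _ => [|a b c d h1 h2|//]; first by rewrite opnorm0.
by rewrite (le_trans (opnormD _ _)) ?lerD.
Qed.

Lemma isometry_vnorm m n (V : 'M[C]_(m, n)) v :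
  adjmx V *m V = 1%:M -> vnorm (V *m v) = vnorm v.
Proof. by move=> VV; rewrite !vnormE rdot_adj mulmxA VV mul1mx. Qed.

Lemma opnorm_isometry m n (V : 'M[C]_(m, n)) : adjmx V *m V = 1%:M -> opnorm V <= 1.
Proof. by move=> VV; apply: opnorm_le => v v1; rewrite isometry_vnorm. Qed.

(** Testing against the normalised vector [A *m v] recovers [vnorm (A *m v)], so real parts of inner
    products suffice. *)
Lemma opnorm_le_rdot m n (A : 'M[C]_(m, n)) c : 0 <= c ->
  (forall u v, vnorm u <= 1 -> vnorm v <= 1 -> rdot u (A *m v) <= c) -> opnorm A <= c.
Proof.
move=> c0 H; apply: opnorm_le => v v1.
have [->//|w0] := eqVneq (vnorm (A *m v)) 0.
have pw : 0 < vnorm (A *m v) by rewrite lt_def w0 vnorm_ge0.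
have := H ((vnorm (A *m v))^-1%:C%C *: (A *m v)) v.
rewrite vnormZ ?invr_ge0 ?vnorm_ge0 // mulVf // lexx => /(_ isT v1).
by rewrite rdotZl -sqr_vnorm expr2 mulrA mulVf // mul1r.
Qed.

Lemma opnorm_adj m n (A : 'M[C]_(m, n)) : opnorm (adjmx A) <= opnorm A.
Proof.
apply: opnorm_le_rdot => [|u v u1 v1]; first exact: opnorm_ge0.
rewrite -rdot_adj (le_trans (rdot_le _ _)) // -[leRHS]mulr1.
by rewrite ler_pM ?vnorm_ge0 ?vnorm_mul_le1.
Qed.

Lemma vnorm_delta n i : vnorm (delta_mx i 0 : 'cV[C]_n) = 1.
Proof.
rewrite vnormE rdotE (bigD1 i) //= big1 => [|j ji].
  by rewrite mxE !eqxx /= mulr1 mulr0 !addr0 sqrtr1.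
by rewrite mxE (negPf ji) /= !mulr0 addr0.
Qed.

Lemma entry_le_opnorm m n (A : 'M[C]_(m, n)) i j :
  Num.sqrt (complex.Re (A i j) ^+ 2 + complex.Im (A i j) ^+ 2) <= opnorm A.
Proof.
have d1 : vnorm (delta_mx j 0 : 'cV[C]_n) <= 1 by rewrite vnorm_delta.
apply: le_trans (vnorm_mul_le1 A d1).
by have := entry_le_vnorm (A *m delta_mx j 0) i; rewrite -colE mxE.
Qed.

Lemma opnorm_delta m n i j : opnorm (delta_mx i j : 'M[C]_(m, n)) <= 1.
Proof.
apply: opnorm_le => v v1.
have -> : delta_mx i j *m v = v j 0 *: delta_mx i 0.
  apply/colP => k; rewrite !mxE (bigD1 j) //= big1 => [|l lj].
    by rewrite !mxE !eqxx !andbT addr0 mulrC.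
  by rewrite mxE (negPf lj) andbF mul0r.
by rewrite vnorm_scale vnorm_delta mulr1; apply: le_trans v1; exact: entry_le_vnorm.
Qed.

End Norms.

Arguments ampl {R} m {n} Phi _.

(** * Amplifications and finiteness of the cb-norm *)

Section Amplification.
Context {R : realType}.
Local Notation C := (R[i]).

Lemma is_linear0 n (T : 'M[C]_n -> 'M[C]_n) : is_linear_map T -> T 0 = 0.
Proof. by move=> T_lin; have := T_lin (-1) 0 0; rewrite !scaleN1r !addNr. Qed.

Lemma is_linear_sum n (T : 'M[C]_n -> 'M[C]_n) (I : Type) (r : seq I) P
    (a : I -> C) (x : I -> 'M[C]_n) : is_linear_map T ->
  T (\sum_(i <- r | P i) a i *: x i) = \sum_(i <- r | P i) a i *: T (x i).
Proof.
move=> T_lin; elim/big_rec2: _ => [|i y z _ <-]; first exact: is_linear0.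
by rewrite T_lin.
Qed.

Lemma is_linear_delta n (T : 'M[C]_n -> 'M[C]_n) x : is_linear_map T ->
  T x = \sum_i \sum_j x i j *: T (delta_mx i j).
Proof.
move=> T_lin; rewrite {1}[x]matrix_sum_delta !pair_big /=.
by rewrite is_linear_sum.
Qed.

Lemma is_linear_sub n (T S : 'M[C]_n -> 'M[C]_n) :
  is_linear_map T -> is_linear_map S -> is_linear_map (fun x => T x - S x).
Proof. by move=> T_lin S_lin a x y; rewrite T_lin S_lin scalerBr opprD addrACA. Qed.

Lemma is_linear_comb n (I : finType) (c : I -> C) (T : I -> 'M[C]_n -> 'M[C]_n) :
  (forall i, is_linear_map (T i)) -> is_linear_map (fun x => \sum_i c i *: T i x).
Proof.
move=> T_lin a x y; rewrite scaler_sumr -big_split /=; apply: eq_bigr => i _.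
by rewrite T_lin scalerDr !scalerA mulrC.
Qed.

Lemma is_linear_mul n N (A : 'M[C]_(n, N)) (B : 'M[C]_(N, n)) (A' : 'M[C]_(n, N))
    (B' : 'M[C]_(N, n)) (T : 'M[C]_N -> 'M[C]_N) : is_linear_map T ->
  is_linear_map (fun x => A *m T (B *m x *m A') *m B').
Proof.
move=> T_lin a x y; rewrite mulmxDr mulmxDl -scalemxAr -scalemxAl T_lin.
by rewrite mulmxDr mulmxDl -scalemxAr -scalemxAl.
Qed.

Lemma is_linear_lr n (A B : 'M[C]_n) : is_linear_map (fun x => A *m x *m B).
Proof. by move=> a x y; rewrite mulmxDr mulmxDl -scalemxAr -scalemxAl. Qed.

Lemma is_linear_tens n k (T : 'M[C]_n -> 'M[C]_n) (S : 'M[C]_k -> 'M[C]_k) :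
  is_linear_map (tens T S).
Proof.
move=> a x y; rewrite /tens scaler_sumr -big_split /=; apply: eq_bigr => i _.
rewrite scaler_sumr -big_split /=; apply: eq_bigr => j _.
rewrite scaler_sumr -big_split /=; apply: eq_bigr => p _.
rewrite scaler_sumr -big_split /=; apply: eq_bigr => q _.
by rewrite !mxE scalerDl scalerA.
Qed.

Lemma big_mxtens_index (V : nmodType) m n (F : 'I_(m * n) -> V) :
  \sum_a F a = \sum_i \sum_j F (mxtens_index (i, j)).
Proof.
rewrite pair_big /= (reindex (@mxtens_index m n)) /=; first by apply: eq_bigr => -[].
by exists (@mxtens_unindex m n) => a _; rewrite ?mxtens_indexK ?mxtens_unindexK.
Qed.

(** On blocks, [ampl m T] is just [T]; identities between amplifications are checked there instead
    of on the fourfold sum in [tens]. *)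
Definition blk m m' n n' (X : 'M[C]_(m * n, m' * n')) i j : 'M[C]_(n, n') :=
  \matrix_(p, q) X (mxtens_index (i, p)) (mxtens_index (j, q)).

Lemma blk_inj m m' n n' (X Y : 'M[C]_(m * n, m' * n')) :
  (forall i j, blk X i j = blk Y i j) -> X = Y.
Proof.
move=> XY; apply/matrixP => a b; case: (mxtens_indexP a) => i p.
by case: (mxtens_indexP b) => j q; have /matrixP/(_ p q) := XY i j; rewrite !mxE.
Qed.

Lemma blk_mul1l m m' n n' N (A : 'M[C]_(n', n)) (X : 'M[C]_(m * n, m' * N)) i j :
  blk ((1%:M *t A) *m X) i j = A *m blk X i j.
Proof.
apply/matrixP => p q; rewrite !mxE big_mxtens_index (bigD1 i) //= [X in _ + X]big1 => [|k ki].
  by rewrite addr0; apply: eq_bigr => r _; rewrite tensmxE !mxE eqxx mul1r.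
by rewrite big1 // => r _; rewrite tensmxE mxE eq_sym (negPf ki) !mul0r.
Qed.

Lemma blk_mul1r m m' n n' N (A : 'M[C]_(n, n')) (X : 'M[C]_(m' * N, m * n)) i j :
  blk (X *m (1%:M *t A)) i j = blk X i j *m A.
Proof.
apply/matrixP => p q; rewrite !mxE big_mxtens_index (bigD1 j) //= [X in _ + X]big1 => [|k ki].
  by rewrite addr0; apply: eq_bigr => r _; rewrite tensmxE !mxE eqxx mul1r.
by rewrite big1 // => r _; rewrite tensmxE mxE (negPf ki) mul0r mulr0.
Qed.

Lemma blk_ampl m n (T : 'M[C]_n -> 'M[C]_n) X i j : is_linear_map T ->
  blk (ampl m T X) i j = T (blk X i j).
Proof.
move=> T_lin; rewrite (is_linear_delta _ T_lin); apply/matrixP => p q.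
rewrite mxE /ampl /tens summxE (bigD1 i) //= summxE (bigD1 j) //=.
rewrite [X in _ + X + _]big1 ?[X in _ + X]big1 ?addr0 => [|k ki|k ki]; first last.
- rewrite summxE big1 // => l _; rewrite summxE big1 // => r _.
  by rewrite mxE tensmxE mxE (eq_sym j) (negPf ki) andbF !(mul0r, mulr0).
- rewrite summxE big1 // => l _; rewrite summxE big1 // => r _.
  rewrite summxE big1 // => s _.
  by rewrite mxE tensmxE mxE eq_sym (negPf ki) !(mul0r, mulr0).
rewrite !summxE; apply: eq_bigr => r _; rewrite !summxE; apply: eq_bigr => s _.
by rewrite [in LHS]mxE tensmxE !mxE !eqxx mul1r.
Qed.

Lemma ampl_mul m n N (A : 'M[C]_(n, N)) (B : 'M[C]_(N, n)) (A' : 'M[C]_(n, N))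
    (B' : 'M[C]_(N, n)) (T : 'M[C]_N -> 'M[C]_N) X : is_linear_map T ->
  ampl m (fun x => A *m T (B *m x *m A') *m B') X =
  (1%:M *t A) *m ampl m T ((1%:M *t B) *m X *m (1%:M *t A')) *m (1%:M *t B').
Proof.
move=> T_lin; apply: blk_inj => i j.
rewrite blk_ampl; last exact: is_linear_mul.
by rewrite blk_mul1r blk_mul1l (blk_ampl _ _ _ T_lin) blk_mul1r blk_mul1l.
Qed.

Lemma blk_sum m m' n n' (I : finType) (F : I -> 'M[C]_(m * n, m' * n')) i j :
  blk (\sum_k F k) i j = \sum_k blk (F k) i j.
Proof. by apply/matrixP => p q; rewrite mxE !summxE; apply: eq_bigr => k _; rewrite mxE. Qed.

Lemma ampl_comb m n (I : finType) (c : I -> C) (T : I -> 'M[C]_n -> 'M[C]_n) X :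
  (forall i, is_linear_map (T i)) ->
  ampl m (fun x => \sum_i c i *: T i x) X = \sum_i c i *: ampl m (T i) X.
Proof.
move=> T_lin; apply: blk_inj => i j.
rewrite blk_ampl; last exact: is_linear_comb.
rewrite blk_sum; apply: eq_bigr => k _; rewrite -(blk_ampl _ _ _ (T_lin k)).
by apply/matrixP => p q; rewrite !mxE.
Qed.

Lemma ampl_sub m n (T S : 'M[C]_n -> 'M[C]_n) X :
  is_linear_map T -> is_linear_map S ->
  ampl m (fun x => T x - S x) X = ampl m T X - ampl m S X.
Proof.
move=> T_lin S_lin; apply: blk_inj => i j.
rewrite blk_ampl; last exact: is_linear_sub.
by rewrite -(blk_ampl _ _ _ T_lin) -(blk_ampl _ _ _ S_lin); apply/matrixP => p q; rewrite !mxE.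
Qed.

Lemma tens1mx1 m n : (1%:M : 'M[C]_m) *t (1%:M : 'M[C]_n) = 1%:M.
Proof.
apply/matrixP => a b; case: (mxtens_indexP a) => i p; case: (mxtens_indexP b) => j q.
rewrite tensmxE !mxE (inj_eq (can_inj (@mxtens_indexK m n))) xpair_eqE -natrM.
by case: eqP; case: eqP.
Qed.

Lemma isometry_tens1 m n N (V : 'M[C]_(N, n)) : adjmx V *m V = 1%:M ->
  adjmx ((1%:M : 'M_m) *t V) *m (1%:M *t V) = 1%:M.
Proof. by move=> VV; rewrite adjmx_tens tensmx_mul adjmx1 mul1mx VV tens1mx1. Qed.

Lemma ampl_lr m n (A B : 'M[C]_n) X :
  ampl m (fun x => A *m x *m B) X = (1%:M *t A) *m X *m (1%:M *t B).
Proof.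
apply: blk_inj => i j; rewrite blk_mul1r blk_mul1l.
exact: (blk_ampl _ _ _ (is_linear_lr A B)).
Qed.

(** [1 (x) A] acts on the [m] blocks of a vector separately, and squared norms of blocks add up. *)
Lemma opnorm_tens1 m n N (A : 'M[C]_(N, n)) : opnorm ((1%:M : 'M_m) *t A) <= opnorm A.
Proof.
have vnorm_blk p (v : 'cV[C]_(m * p)) : vnorm v ^+ 2 =
    \sum_i vnorm (\col_j v (mxtens_index (i, j)) 0) ^+ 2.
  rewrite sqr_vnorm rdotE big_mxtens_index; apply: eq_bigr => i _.
  by rewrite sqr_vnorm rdotE; apply: eq_bigr => j _; rewrite !mxE.
apply: opnorm_le => v v1.
suff : vnorm ((1%:M *t A) *m v) ^+ 2 <= (opnorm A * vnorm v) ^+ 2.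
  rewrite ler_pXn2r ?nnegrE ?mulr_ge0 ?vnorm_ge0 ?opnorm_ge0 // => /le_trans -> //.
  by rewrite -[leRHS]mulr1 ler_wpM2l ?opnorm_ge0.
rewrite exprMn !vnorm_blk mulr_sumr; apply: ler_sum => i _; rewrite -exprMn.
rewrite ler_pXn2r ?nnegrE ?mulr_ge0 ?vnorm_ge0 ?opnorm_ge0 //.
apply: le_trans (vnorm_mul_le _ _); rewrite le_eqVlt; apply/orP; left; apply/eqP.
congr vnorm; apply/colP => p; rewrite !mxE big_mxtens_index (bigD1 i) //= [X in _ + X]big1 => [|k ki].
  by rewrite addr0; apply: eq_bigr => r _; rewrite tensmxE !mxE eqxx mul1r.
by rewrite big1 // => r _; rewrite tensmxE mxE eq_sym (negPf ki) !mul0r.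
Qed.

Lemma cbnorm_le n (T : 'M[C]_n -> 'M[C]_n) c :
  (forall m X, opnorm X <= 1 -> opnorm (ampl m T X) <= c) -> cbnorm T <= c.
Proof.
move=> H; apply: ge_sup => [|_ [m ->]]; first by exists (mapnorm (ampl 0 T)); exists 0%N.
apply: ge_sup => [|_ [X X1 <-]]; last exact: H.
by exists (opnorm (ampl m T 0)); exists 0 => //=; rewrite opnorm0.
Qed.

(* Expanding [T] in matrix units bounds its amplifications uniformly in [m]. *)
Lemma ampl_bounded n (T : 'M[C]_n -> 'M[C]_n) : is_linear_map T ->
  exists c, forall m X, opnorm X <= 1 -> opnorm (ampl m T X) <= c.
Proof.
move=> T_lin; pose I := ('I_n * 'I_n * 'I_n * 'I_n)%type.
(* Chosen so that [A t *m x *m B t] is [e_rs] with coefficient [x p q * T(e_pq) r s]. A map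
   [x |-> A x B] has amplifications of norm at most [opnorm A * opnorm B], whatever [m]. *)
pose A (t : I) : 'M[C]_n :=
  let: (p, q, r, s) := t in (T (delta_mx p q)) r s *: delta_mx r p.
pose B (t : I) : 'M[C]_n := let: (p, q, r, s) := t in delta_mx q s.
exists (\sum_t opnorm (A t) * opnorm (B t)) => m X X1.
have -> : T = fun x => \sum_t 1 *: (A t *m x *m B t).
  apply/funext => x.
  transitivity (\sum_p \sum_q \sum_r \sum_s A (p, q, r, s) *m x *m B (p, q, r, s)).
    rewrite (is_linear_delta x T_lin); apply: eq_bigr => p _; apply: eq_bigr => q _.
    rewrite [T (delta_mx p q)]matrix_sum_delta scaler_sumr; apply: eq_bigr => r _.
    rewrite scaler_sumr; apply: eq_bigr => s _.
    apply/matrixP => i j; rewrite !mxE (bigD1 q) //= big1 => [|k kq]; last first.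
      by rewrite !mxE (negPf kq) mulr0.
    rewrite !mxE (bigD1 p) //= big1 => [|k kp]; last first.
      by rewrite !mxE (negPf kp) andbF !(mulr0, mul0r).
    rewrite !mxE !eqxx !andbT /= !addr0.
    by rewrite -mulnb natrM; ring.
  by rewrite !pair_big /=; apply: eq_bigr => -[[[p q] r] s] _; rewrite scale1r.
rewrite ampl_comb => [|t]; last exact: is_linear_lr.
apply: le_trans (opnorm_sum _ _ _) _; apply: ler_sum => t _.
rewrite scale1r ampl_lr; apply: le_trans (opnormM _ _) _.
apply: ler_pM (opnorm_ge0 _) (opnorm_ge0 _) _ (opnorm_tens1 _ _).
apply: le_trans (opnormM _ _) _; rewrite -[leRHS]mulr1.
exact: ler_pM (opnorm_ge0 _) (opnorm_ge0 _) (opnorm_tens1 _ _) X1.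
Qed.

Lemma cbnorm_ge n (T : 'M[C]_n -> 'M[C]_n) m X : is_linear_map T ->
  opnorm X <= 1 -> opnorm (ampl m T X) <= cbnorm T.
Proof.
move=> T_lin X1; have [c Tc] := ampl_bounded T_lin.
have Tc' m' : mapnorm (ampl m' T) <= c.
  apply: ge_sup => [|_ [Y Y1 <-]]; last exact: Tc.
  by exists (opnorm (ampl m' T 0)); exists 0 => //=; rewrite opnorm0.
apply: (@le_trans _ _ (mapnorm (ampl m T))).
  by apply: ub_le_sup; [exists c => _ [Y Y1 <-]; exact: Tc|exists X].
by apply: ub_le_sup; [exists c => _ [m' ->]|exists m].
Qed.

Lemma cbnorm_ge0 n (T : 'M[C]_n -> 'M[C]_n) : is_linear_map T -> 0 <= cbnorm T.
Proof.
move=> T_lin; apply: (le_trans (opnorm_ge0 (ampl 0 T 0))).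
by apply: cbnorm_ge; rewrite ?opnorm0.
Qed.

End Amplification.

(** * Singular values; contractions as averages of two unitaries *)

Section ContractionAverage.
Context {R : realType}.
Local Notation C := (R[i]).

Lemma unitary_left n (u : 'M[C]_n) : u *m adjmx u = 1%:M -> unitary u.
Proof. by move=> uu; split=> //; apply: mulmx1C. Qed.

Lemma unitary_adj n (u : 'M[C]_n) : unitary u -> unitary (adjmx u).
Proof. by case=> u1 u2; split; rewrite adjmxK. Qed.

Lemma unitary_mul n (u v : 'M[C]_n) : unitary u -> unitary v -> unitary (u *m v).
Proof.
case=> uu _ [vv _]; apply: unitary_left.
by rewrite adjmxM mulmxA -(mulmxA u) vv mulmx1.
Qed.

Lemma unitary1 n : unitary (1%:M : 'M[C]_n).
Proof. by apply: unitary_left; rewrite adjmx1 mulmx1. Qed.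

Lemma opnorm_unitary n (u : 'M[C]_n) : unitary u -> opnorm u <= 1.
Proof. by case=> _; apply: opnorm_isometry. Qed.

Lemma adjmx_diag n (d : 'rV[C]_n) : adjmx (diag_mx d) = diag_mx (map_mx (@conjc R) d).
Proof.
apply/matrixP => i j; rewrite !mxE eq_sym.
by case: eqVneq => [->|_]; rewrite ?mulr1n // mulr0n rmorph0.
Qed.

(** Half of a singular value decomposition: the unitary diagonalising [A A^*] makes the rows of
    [P *m A] pairwise orthogonal. *)
Lemma spectral_gram n (A : 'M[C]_n) :
  exists P d, unitary P /\ (P *m A) *m adjmx (P *m A) = diag_mx d.
Proof.
have adjE (M : 'M[C]_n) : map_mx Num.conj M^T = adjmx M.
  by apply/matrixP => i j; rewrite !mxE.
have nA : A *m adjmx A \is normalmx.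
  by apply/normalmxP; rewrite adjE adjmxM adjmxK.
have := orthomx_spectralP nA; set P := spectralmx _; set d := spectral_diag _ => AE.
have uP : unitary P.
  by apply: unitary_left; rewrite -adjE; apply/unitarymxP/spectral_unitarymx.
exists P, d; split=> //; rewrite adjmxM mulmxA -(mulmxA P) AE.
rewrite invmx_unitary ?spectral_unitarymx // adjE -/P.
by rewrite !mulmxA uP.1 mul1mx -mulmxA uP.1 mulmx1.
Qed.

Lemma gram_row n m (A : 'M[C]_(n, m)) i j :
  (A *m adjmx A) i j = (row i A *m adjmx (row j A)) 0 0.
Proof. by rewrite !mxE; apply: eq_bigr => k _; rewrite !mxE. Qed.

Lemma gram_diag_ge0 n m (B : 'M[C]_(n, m)) d i : B *m adjmx B = diag_mx d ->
  d 0 i = (vnorm (adjmx (row i B)) ^+ 2)%:C%C.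
Proof.
move=> /matrixP/(_ i i); rewrite !mxE eqxx mulr1n => <-.
rewrite sqr_vnorm rdotE; apply/eqP; rewrite eq_complex /= !raddf_sum; apply/andP; split.
  by apply/eqP/eq_bigr => j _; rewrite !mxE; case: (B i j) => a b /=; ring.
by rewrite big1 // => j _; rewrite !mxE; case: (B i j) => a b /=; ring.
Qed.

(* Zero rows are replaced, one at a time, by vectors orthogonal to all the rows. *)
Lemma gram_diag_factor n (B : 'M[C]_n) d : B *m adjmx B = diag_mx d ->
  exists2 Q, unitary Q & forall i, row i B = (Num.sqrt (complex.Re (d 0 i)))%:C%C *: row i Q.
Proof.
(* Induction on the number of zero rows, since [d 0 i] is the squared norm of row [i]. *)
have [k] := ubnP #|[set i | d 0 i == 0]|%SET.
elim: k B d => // k IHk B d; rewrite ltnS => dk BB.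
have [[i di]|d0] := pselect (exists i, d 0 i = 0).
  have Bi : row i B = 0.
    have /eqP := gram_diag_ge0 i BB.
    rewrite di eq_sym => /eqP/(@complexI _) /eqP; rewrite sqrf_eq0 => /eqP/vnorm_eq0 Bi.
    by rewrite -[LHS]adjmxK Bi; apply/matrixP => a b; rewrite !mxE rmorph0.
  (* The zero row makes [adjmx B] singular. *)
  have [x xB x0] : exists2 x : 'rV[C]_n, x *m adjmx B = 0 & x != 0.
    have : kermx (adjmx B) != 0.
      rewrite kermx_eq0 row_free_unit; apply/negP => uB.
      have : adjmx B *m delta_mx i 0 = 0 :> 'cV_n.
        rewrite -colE; apply/colP => a.
        by have /rowP/(_ a) := Bi; rewrite !mxE => ->; rewrite rmorph0.
      move=> /(congr1 (mulmx (invmx (adjmx B)))); rewrite mulKmx // mulmx0.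
      by move=> /colP/(_ i); rewrite !mxE !eqxx => /eqP; rewrite oner_eq0.
    by move=> /rowV0Pn[x /sub_kermxP]; exists x.
  pose B' := \matrix_j (if j == i then x else row j B).
  pose d' := \row_j (if j == i then (x *m adjmx x) 0 0 else d 0 j).
  have BB' : B' *m adjmx B' = diag_mx d'.
    have xBE a : (x *m adjmx (row a B)) 0 0 = 0.
      have /rowP/(_ a) := xB; rewrite !mxE => xBa; rewrite -[RHS]xBa.
      by apply: eq_bigr => l _; rewrite !mxE.
    apply/matrixP => a b; rewrite gram_row !rowK [RHS]mxE [X in _ = X *+ _]mxE.
    have [->|ai] := eqVneq a i; have [bi|bi] := eqVneq b i.
    - by [].
    - by rewrite xBE.
    - rewrite bi (negPf ai) mulr0n -[LHS]conjcK; apply/eqP; rewrite conjc_eq0; apply/eqP.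
      rewrite -(xBE a) !mxE rmorph_sum; apply: eq_bigr => l _.
      by rewrite !mxE rmorphM /= conjcK mulrC.
    - by rewrite -gram_row BB mxE.
  have [|Q uQ QP] := IHk B' d' _ BB'.
    apply: leq_trans dk; apply: proper_card; apply/properP; split.
      apply/fintype.subsetP => j; rewrite !inE mxE.
      by have [->|//] := eqVneq j i; rewrite di eqxx.
    exists i; rewrite !inE ?di // mxE eqxx; apply: contra x0 => /eqP xx.
    suff /vnorm_eq0 : vnorm (adjmx x) = 0.
      by move=> x'0; rewrite -[x]adjmxK x'0; apply/eqP/matrixP => a b; rewrite !mxE rmorph0.
    by apply/eqP; rewrite -sqrf_eq0 sqr_vnorm /rdot adjmxK xx.
  (* The same [Q] serves [B]: only row [i] was altered, and for it both sides vanish. *)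
  exists Q => // j; have := QP j; rewrite rowK mxE.
  have [->|//] := eqVneq j i; by rewrite Bi di /= sqrtr0 scale0r.
(* Without zero rows, normalising each row gives [Q]. *)
pose s i := Num.sqrt (complex.Re (d 0 i)).
have sE i : s i = vnorm (adjmx (row i B)).
  by rewrite /s (gram_diag_ge0 i BB) /= sqrtr_sqr ger0_norm ?vnorm_ge0.
have s0 i : s i != 0.
  apply/eqP => si; apply: d0; exists i.
  by rewrite (gram_diag_ge0 i BB) -sE si expr0n.
exists (diag_mx (\row_i (s i)^-1%:C%C) *m B).
  apply: unitary_left; rewrite adjmxM mulmxA -(mulmxA _ B) BB adjmx_diag.
  rewrite !mulmx_diag -diag_const_mx; congr diag_mx; apply/rowP => i.
  rewrite !mxE conjc_real (gram_diag_ge0 i BB) -sE -!rmorphM /=.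
  by rewrite expr2 mulrA mulVf // mul1r mulfV.
move=> i; apply/rowP => j; rewrite mul_diag_mx !mxE mulrA -rmorphM -/(s i) divff //.
by rewrite mul1r.
Qed.

Lemma unitary_diag n (z : 'rV[C]_n) :
  (forall i, z 0 i * conjc (z 0 i) = 1) -> unitary (diag_mx z).
Proof.
move=> zz; apply: unitary_left; rewrite adjmx_diag mulmx_diag -diag_const_mx.
by congr diag_mx; apply/rowP => i; rewrite !mxE zz.
Qed.

(* Each singular value [s] is the average of the unimodular numbers [s +- i sqrt (1 - s^2)]. *)
Lemma contraction_average n (v : 'M[C]_n) : opnorm v <= 1 ->
  exists w1 w2, [/\ unitary w1, unitary w2 & v = 2^-1%:C%C *: (w1 + w2)].
Proof.
move=> v1; have [P [d [uP PP]]] := spectral_gram v.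
have [Q uQ QP] := gram_diag_factor PP.
pose s i := Num.sqrt (complex.Re (d 0 i)).
have s1 i : s i <= 1.
  rewrite /s (gram_diag_ge0 i PP) /= sqrtr_sqr ger0_norm ?vnorm_ge0 //.
  have -> : adjmx (row i (P *m v)) = adjmx (P *m v) *m delta_mx i 0.
    by rewrite -colE; apply/matrixP => a b; rewrite !mxE.
  have d1 : vnorm (delta_mx i 0 : 'cV[C]_n) <= 1 by rewrite vnorm_delta.
  apply: le_trans (vnorm_mul_le1 _ d1) _.
  exact: le_trans (opnorm_adj _) (opnorm_mul_le1 (opnorm_unitary uP) v1).
pose z : 'rV[C]_n := \row_i Complex (s i) (Num.sqrt (1 - s i ^+ 2)).
have zz i : z 0 i * conjc (z 0 i) = 1.
  have s2 : 0 <= 1 - s i ^+ 2 by rewrite subr_ge0 expr_le1 ?sqrtr_ge0 ?s1.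
  apply/eqP; rewrite mxE eq_complex /=; apply/andP; split; apply/eqP; last first.
    by rewrite mulrN mulrC addNr.
  by rewrite mulrN opprK -!expr2 (sqr_sqrtr s2) addrC subrK.
(* [v] is [P^* diag(s) Q]; a unimodular diagonal in place of [s] gives a unitary, and [s] is the
   mean of [z] and its conjugate. *)
pose w y := adjmx P *m diag_mx y *m Q.
have uw (y : 'rV[C]_n) : (forall i, y 0 i * conjc (y 0 i) = 1) -> unitary (w y).
  by move=> yy; apply: unitary_mul => //; apply: unitary_mul; [exact: unitary_adj|exact: unitary_diag].
exists (w z), (w (map_mx (@conjc R) z)); split; [exact: uw| |].
  by apply: uw => i; rewrite mxE conjcK mulrC.
rewrite /w -mulmxDl -mulmxDr -raddfD /= -[v]mul1mx -uP.2 -mulmxA.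
rewrite scalemxAl scalemxAr -mulmxA; congr mulmx.
apply/row_matrixP => i; rewrite QP; apply/rowP => j.
rewrite -scalemxAl mul_diag_mx !mxE mulrA; congr (_ * _).
by apply/eqP; rewrite eq_complex /=; apply/andP; split; apply/eqP; rewrite -/(s i); field.
Qed.

End ContractionAverage.

(** * Compression to a corner and the factor 2 *)

Section Compression.
Context {R : realType}.
Local Notation C := (R[i]).

Lemma Aut_linear n (Phi : 'M[C]_n -> 'M[C]_n) : Aut Phi -> is_linear_map Phi.
Proof. by case=> u [_ ->]; apply: is_linear_lr. Qed.

Lemma convAut_linear n (Phi : 'M[C]_n -> 'M[C]_n) : convAut Phi -> is_linear_map Phi.
Proof.
case=> l [lam [Ph [_ [_ [Ph_Aut ->]]]]].
by apply: is_linear_comb => i; apply: Aut_linear.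
Qed.

Lemma convAut_unital n (Phi : 'M[C]_n -> 'M[C]_n) : convAut Phi -> Phi 1%:M = 1%:M.
Proof.
case=> l [lam [Ph [_ [lam1 [Ph_Aut ->]]]]].
rewrite (eq_bigr (fun i => (lam i)%:C%C *: 1%:M)) => [|i _]; last first.
  by case: (Ph_Aut i) => u [[_ uu] ->]; rewrite mulmx1 uu.
by rewrite -scaler_suml -rmorph_sum lam1 scale1r.
Qed.

Lemma convAut_finType n (I : finType) (lam : I -> R) (u : I -> 'M[C]_n) :
  (forall i, 0 <= lam i) -> \sum_i lam i = 1 -> (forall i, unitary (u i)) ->
  convAut (fun x => \sum_i (lam i)%:C%C *: (adjmx (u i) *m x *m u i)).
Proof.
move=> lam0 lam1 uu.
exists #|I|, (lam \o enum_val), (fun i x => adjmx (u (enum_val i)) *m x *m u (enum_val i)).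
have sumE (W : nmodType) (F : I -> W) : \sum_i F i = \sum_(i < #|I|) F (enum_val i).
  by rewrite (reindex _ (onW_bij _ (@enum_val_bij I))).
split=> [i|]; first exact: lam0.
split; first by rewrite -lam1 sumE.
split=> [i|]; first by exists (u (enum_val i)).
by apply/funext => x; rewrite sumE.
Qed.

(** Makes the set under the [inf] of [dcb] nonempty, as lower bounds on [inf] require. *)
Lemma convAut_id n : convAut (@id 'M[C]_n).
Proof.
have := @convAut_finType n unit (fun=> 1) (fun=> 1%:M) (fun=> ler01).
rewrite !big_const !card_unit /= addr0 => /(_ erefl (fun=> unitary1 n)); congr (convAut _).
by apply/funext => x; rewrite big_const card_unit /= addr0 scale1r adjmx1 mulmx1 mul1mx.
Qed.

(** [F] is completely positive in Kraus form. With [D_i = 1 (x) d_i], each term of [<u, F(X) v>] is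
    at most [c_i (|D_i u|^2 + |D_i v|^2) / 2] by Cauchy-Schwarz and AM-GM, and
    [sum c_i |D_i u|^2 = <u, F(1) u>]. *)
Lemma opnorm_cp_le n (I : finType) (c : I -> R) (d : I -> 'M[C]_n) m X
    (F := fun x => \sum_i (c i)%:C%C *: (adjmx (d i) *m x *m d i)) :
  (forall i, 0 <= c i) -> opnorm X <= 1 ->
  opnorm (ampl m F X) <= opnorm (ampl m F 1%:M).
Proof.
move=> c0 X1; pose D i : 'M[C]_(m * n) := 1%:M *t d i.
have FE Y : ampl m F Y = \sum_i (c i)%:C%C *: (adjmx (D i) *m Y *m D i).
  rewrite ampl_comb => [|i]; last exact: is_linear_lr.
  by apply: eq_bigr => i _; rewrite ampl_lr adjmx_tens adjmx1.
have FEr Y u v : rdot u (ampl m F Y *m v) = \sum_i c i * rdot (D i *m u) (Y *m (D i *m v)).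
  rewrite FE mulmx_suml rdot_sumr; apply: eq_bigr => i _.
  by rewrite -scalemxAl rdotZr rdot_adj !mulmxA.
have F1 u : vnorm u <= 1 -> \sum_i c i * vnorm (D i *m u) ^+ 2 <= opnorm (ampl m F 1%:M).
  move=> u1; rewrite (eq_bigr (fun i => c i * rdot (D i *m u) (1%:M *m (D i *m u)))).
    rewrite -FEr; apply: le_trans (rdot_le _ _) _; rewrite -[leRHS]mul1r.
    by rewrite ler_pM ?vnorm_ge0 ?vnorm_mul_le1.
  by move=> i _; rewrite mul1mx sqr_vnorm.
apply: opnorm_le_rdot => [|u v u1 v1]; first exact: opnorm_ge0.
apply: (@le_trans _ _ ((\sum_i c i * vnorm (D i *m u) ^+ 2 +
                        \sum_i c i * vnorm (D i *m v) ^+ 2) / 2)); last first.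
  by rewrite ler_pdivrMr // mulr_natr mulr2n lerD ?F1.
rewrite FEr -big_split mulr_suml; apply: ler_sum => i _; rewrite /= -mulrDr -mulrA.
rewrite ler_wpM2l //; apply: le_trans (rdot_le _ _) _.
have := ler_wpM2l (vnorm_ge0 (D i *m u)) (vnorm_mul_le X (D i *m v)).
have := ler_wpM2r (mulr_ge0 (vnorm_ge0 (D i *m u)) (vnorm_ge0 (D i *m v))) X1.
have := sqr_ge0 (vnorm (D i *m u) - vnorm (D i *m v)).
by nra.
Qed.

(* The isometry [x |-> x (x) e_p]. *)
Definition embmx n k (p : 'I_k) : 'M[C]_(n * k, n) :=
  \matrix_(a, j) (a == mxtens_index (j, p))%:R.

Lemma mxtens_index_eq m n (i i' : 'I_m) (j j' : 'I_n) :
  (mxtens_index (i, j) == mxtens_index (i', j')) = (i == i') && (j == j').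
Proof. by rewrite (inj_eq (can_inj (@mxtens_indexK m n))) xpair_eqE. Qed.

Lemma embmx_isometry n k (p : 'I_k) : adjmx (embmx n p) *m embmx n p = 1%:M.
Proof.
apply/matrixP => i j; rewrite !mxE (bigD1 (mxtens_index (i, p))) //= big1 => [|a ai].
  by rewrite !mxE eqxx rmorph1 mul1r addr0 mxtens_index_eq eqxx andbT.
by rewrite !mxE (negPf ai) rmorph0 mul0r.
Qed.

Lemma embmx_conj n k (p : 'I_k) x :
  embmx n p *m x *m adjmx (embmx n p) = x *t delta_mx p p.
Proof.
apply/matrixP => a b; case: (mxtens_indexP a) => i r; case: (mxtens_indexP b) => j s.
rewrite tensmxE !mxE (bigD1 j) //= big1 => [|l lj].
  rewrite !mxE (bigD1 i) //= big1 => [|l li].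
    rewrite !mxE !mxtens_index_eq !eqxx /= rmorph_nat !addr0 -mulnb natrM; ring.
  by rewrite !mxE mxtens_index_eq eq_sym (negPf li) mul0r.
by rewrite !mxE mxtens_index_eq (eq_sym j) (negPf lj) rmorph0 mulr0.
Qed.

Lemma embmx_compress n k (p : 'I_k) x :
  adjmx (embmx n p) *m (x *t delta_mx p p) *m embmx n p = x.
Proof. by rewrite -embmx_conj !mulmxA embmx_isometry mul1mx -mulmxA embmx_isometry mulmx1. Qed.

Lemma tens_deltar n k (T : 'M[C]_n -> 'M[C]_n) (S : 'M[C]_k -> 'M[C]_k) x p q :
  is_linear_map T -> tens T S (x *t delta_mx p q) = T x *t S (delta_mx p q).
Proof.
move=> T_lin; rewrite (is_linear_delta x T_lin) /tens.
apply/matrixP => a b; rewrite mxE !summxE mulr_suml; apply: eq_bigr => i _.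
rewrite !summxE mulr_suml; apply: eq_bigr => j _.
rewrite !summxE (bigD1 p) //= summxE (bigD1 q) //= big1 => [|s sq]; last first.
  by rewrite mxE tensmxE !mxE (negPf sq) andbF mulr0 mul0r.
rewrite big1 => [|r rp]; last first.
  by rewrite summxE big1 // => s _; rewrite mxE tensmxE !mxE (negPf rp) mulr0 mul0r.
by rewrite mxE tensmxE !mxE !eqxx /= mulr1 !addr0 mulrA.
Qed.

(** Every block of the identity is 0 or 1, so the value at 1 determines the amplified value at 1. *)
Lemma ampl1_eq m n (T S : 'M[C]_n -> 'M[C]_n) : is_linear_map T -> is_linear_map S ->
  T 1%:M = S 1%:M -> ampl m T 1%:M = ampl m S 1%:M.
Proof.
move=> T_lin S_lin TS; apply: blk_inj => i j; rewrite !blk_ampl //.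
have -> : blk (1%:M : 'M[C]_(m * n)) i j = (i == j)%:R *: 1%:M + 0.
  apply/matrixP => p q; rewrite !mxE mxtens_index_eq addr0.
  by case: (i == j); rewrite ?mul1r ?mul0r.
by rewrite T_lin S_lin TS (is_linear0 T_lin) (is_linear0 S_lin).
Qed.

(** The amplified compression is a compression by [1 (x) V], again an isometry, so multiplying by it
    or its adjoint does not increase norms. *)
Lemma cbnorm_compress n N (V : 'M[C]_(N, n)) (T : 'M[C]_N -> 'M[C]_N) m X :
  is_linear_map T -> adjmx V *m V = 1%:M -> opnorm X <= 1 ->
  opnorm (ampl m (fun x => adjmx V *m T (V *m x *m adjmx V) *m V) X) <= cbnorm T.
Proof.
move=> T_lin VV X1; rewrite (ampl_mul _ _ _ _ _ T_lin).
have V1 := opnorm_isometry (isometry_tens1 m VV).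
have V1' : opnorm ((1%:M : 'M[C]_m) *t adjmx V) <= 1.
  apply: le_trans (opnorm_tens1 _ _) _; apply: le_trans (opnorm_adj _) _.
  exact: opnorm_isometry.
have Y1 := opnorm_mul_le1 (opnorm_mul_le1 V1 X1) V1'.
have TY := cbnorm_ge T_lin Y1.
apply: le_trans (opnormM _ _) _; rewrite -[leRHS]mulr1.
apply: ler_pM (opnorm_ge0 _) (opnorm_ge0 _) _ V1.
apply: le_trans (opnormM _ _) _; rewrite -[leRHS]mul1r.
exact: ler_pM (opnorm_ge0 _) (opnorm_ge0 _) V1' TY.
Qed.

(** A parallelogram identity: the mixed terms [w1^* x w2] and [w2^* x w1] cancel on the right. *)
Lemma ad_average n (w1 w2 x : 'M[C]_n) (h := 2^-1%:C%C : C) :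
  h *: (adjmx w1 *m x *m w1 + adjmx w2 *m x *m w2) =
  adjmx (h *: (w1 + w2)) *m x *m (h *: (w1 + w2)) +
  adjmx (h *: (w1 - w2)) *m x *m (h *: (w1 - w2)).
Proof.
rewrite /h !adjmxZ adjmxD adjmxB -/h.
move: (adjmx w1) (adjmx w2) => a1 a2.
rewrite -!scalemxAl -!scalemxAr !scalerA -scalerDr -scalerA; congr (_ *: _).
rewrite !mulmxDl !mulmxDr !mulNmx !mulmxN opprK.
move: (a1 *m x *m w1) (a1 *m x *m w2) (a2 *m x *m w1) (a2 *m x *m w2) => a b c d.
have h2 : h + h = 1 by rewrite /h -rmorphD (_ : 2^-1 + 2^-1 = 1) //; field.
apply/matrixP => i j; rewrite !mxE.
move: (a i j) (b i j) (c i j) (d i j) => a' b' c' d'.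
by transitivity ((h + h) * (a' + d')); [rewrite h2 mul1r | ring].
Qed.

Lemma convAut_compress n k (T : 'M[C]_n -> 'M[C]_n) (S : 'M[C]_k -> 'M[C]_k) p Phi :
  is_linear_map T -> T 1%:M = 1%:M -> S (delta_mx p p) = delta_mx p p -> convAut Phi ->
  exists2 Psi, convAut Psi &
    cbnorm (fun x => T x - Psi x) <= 2 * cbnorm (fun x => tens T S x - Phi x).
Proof.
move=> T_lin T1 Sp Phi_conv; set V := embmx n p.
have D_lin := is_linear_sub (is_linear_tens T S) (convAut_linear Phi_conv).
have [l [lam [Ph [lam0 [lam1 [Ph_Aut PhiE]]]]]] := Phi_conv.
have [u uP] := choice Ph_Aut.
pose v i := adjmx V *m u i *m V.
have VV : adjmx V *m V = 1%:M by exact: embmx_isometry.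
have v1 i : opnorm (v i) <= 1.
  have V1 := opnorm_isometry VV; have V1' := le_trans (opnorm_adj V) V1.
  by case: (uP i) => /opnorm_unitary u1 _; exact: (opnorm_mul_le1 (opnorm_mul_le1 V1' u1) V1).
have [w1 w1P] := choice (fun i => contraction_average (v1 i)).
have [w2 wP] := choice w1P.
pose d i := 2^-1%:C%C *: (w1 i - w2 i).
(* Each [v_i] is split into two unitaries, each carrying half of its weight. *)
pose w (t : 'I_l * bool) := if t.2 then w1 t.1 else w2 t.1.
pose Psi x := \sum_t (lam t.1 / 2)%:C%C *: (adjmx (w t) *m x *m w t).
pose E x := adjmx V *m (tens T S (V *m x *m adjmx V) - Phi (V *m x *m adjmx V)) *m V.
pose F x := \sum_i (lam i)%:C%C *: (adjmx (d i) *m x *m d i).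
have Psi_conv : convAut Psi.
  apply: convAut_finType => [t||[i []]]; first by rewrite divr_ge0.
  - rewrite -(pair_bigA _ (fun i (b : bool) => lam i / 2)) /= -[RHS]lam1; apply: eq_bigr => i _.
    by rewrite big_bool /= -splitr.
  - by case: (wP i).
  - by case: (wP i).
have E_lin : is_linear_map E by exact: (is_linear_mul (adjmx V) V (adjmx V) V D_lin).
have F_lin : is_linear_map F by apply: is_linear_comb => i; exact: is_linear_lr.
(* [E] is [T - sum lam_i Ad(v_i)], and by [ad_average] [Psi] is [sum lam_i Ad(v_i) + F]. *)
have EFE x : T x - Psi x = E x - F x.
  have -> : E x = T x - \sum_i (lam i)%:C%C *: (adjmx (v i) *m x *m v i).
    rewrite /E embmx_conj tens_deltar // Sp mulmxBr mulmxBl embmx_compress -embmx_conj.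
    congr (_ - _); rewrite PhiE mulmx_sumr mulmx_suml; apply: eq_bigr => i _.
    rewrite -scalemxAr -scalemxAl; case: (uP i) => _ ->.
    by rewrite /v !adjmxM adjmxK !mulmxA.
  rewrite -addrA -opprD -big_split; congr (_ - _).
  rewrite /Psi -(pair_bigA _ (fun i b => (lam i / 2)%:C%C *:
    (adjmx (w (i, b)) *m x *m w (i, b)))) /=.
  apply: eq_bigr => i _; rewrite big_bool /w /= -!scalerDr rmorphM -scalerA ad_average.
  by case: (wP i) => _ _ <-.
exists Psi => //.
have E_le m X : opnorm X <= 1 ->
    opnorm (ampl m E X) <= cbnorm (fun x => tens T S x - Phi x).
  by move=> X1; exact: (cbnorm_compress D_lin VV X1).
apply: cbnorm_le => m X X1.
have -> : (fun x => T x - Psi x) = (fun x => E x - F x) by apply/funext => x; exact: EFE.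
rewrite ampl_sub //; apply: le_trans (opnormD _ _) _.
rewrite opnormN mulr_natl mulr2n; apply: lerD; first exact: E_le.
apply: le_trans (@opnorm_cp_le _ _ lam d m X lam0 X1) _; rewrite -/F.
(* [T] and [Psi] are both unital, so [E - F] vanishes at 1 and the norm of [F] is controlled by a
   value of [E]. *)
have -> : ampl m F 1%:M = ampl m E 1%:M.
  apply: ampl1_eq => //; apply/eqP; rewrite eq_sym -subr_eq0 -EFE T1.
  by rewrite convAut_unital // subrr.
by apply: E_le; apply: opnorm_unitary; exact: unitary1.
Qed.

End Compression.

(** * Caratheodory's theorem on convex combinations *)

Section Caratheodory.
Context {R : realFieldType}.

Lemma affine_dependence D l (p : 'I_l.+1 -> 'rV[R]_D) : (D < l)%N ->
  exists mu : 'I_l.+1 -> R,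
    [/\ \sum_i mu i = 0, \sum_i mu i *: p i = 0 & exists i, 0 < mu i].
Proof.
(* The column of ones encodes [sum mu = 0]; with [D + 1 < l + 1] columns the rows are dependent. *)
move=> Dl; pose M := row_mx (\matrix_i p i) (const_mx 1 : 'cV[R]_l.+1).
have : kermx M != 0.
  rewrite kermx_eq0; apply/negP => /eqP rM.
  by have := rank_leq_col M; rewrite rM addn1 ltnNge Dl.
move=> /rowV0Pn[mu /sub_kermxP]; rewrite mul_mx_row => muM mu0.
have := congr1 lsubmx muM; rewrite row_mxKl linear0 => muP.
have := congr1 rsubmx muM; rewrite row_mxKr linear0 => mu1.
 exists (fun i => mu 0 i).
have sum0 : \sum_i mu 0 i = 0.
  have /rowP/(_ 0) := mu1; rewrite !mxE => muE; rewrite -[RHS]muE.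
  by apply: eq_bigr => i _; rewrite mxE mulr1.
split=> //.
  rewrite -[RHS]muP; apply/rowP => j; rewrite !mxE summxE.
  by apply: eq_bigr => i _; rewrite !mxE.
(* Coefficients that are all nonpositive and sum to 0 would vanish. *)
apply/existsP; apply: contraNT mu0 => /existsPn mu_le.
have : \sum_i - mu 0 i = 0 by rewrite sumrN sum0 oppr0.
move=> /psumr_eq0P mu0; apply/eqP/rowP => i; rewrite mxE.
apply/eqP; rewrite -oppr_eq0; apply/eqP/mu0 => // j _.
by rewrite oppr_ge0 leNgt mu_le.
Qed.

Lemma caratheodory_step D l (p : 'I_l.+1 -> 'rV[R]_D) (lam : 'I_l.+1 -> R) :
  (D < l)%N -> (forall i, 0 <= lam i) -> \sum_i lam i = 1 ->
  exists (lam' : 'I_l.+1 -> R) i0, [/\ forall i, 0 <= lam' i, \sum_i lam' i = 1,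
    lam' i0 = 0 & \sum_i lam' i *: p i = \sum_i lam i *: p i].
Proof.
move=> Dl lam0 lam1; have [mu [mu0 mup [i mui]]] := affine_dependence p Dl.
(* The smallest ratio is the largest multiple of [mu] that can be subtracted before a weight turns
   negative; it annihilates the weight of [i0]. *)
have [i0 mui0 i0_min] := @Order.TotalTheory.arg_minP _ R _ i (fun i => 0 < mu i)
  (fun i => lam i / mu i) mui.
exists (fun i => lam i - lam i0 / mu i0 * mu i), i0; split.
- move=> j; rewrite subr_ge0; have [muj|muj] := ltP 0 (mu j).
    by rewrite -ler_pdivlMr // i0_min.
  by apply: le_trans (lam0 j); rewrite mulr_ge0_le0 // divr_ge0 // ltW.
- by rewrite sumrB -mulr_sumr mu0 mulr0 subr0.
- by rewrite divfK ?subrr // gt_eqF.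
- rewrite (eq_bigr (fun i => lam i *: p i - (lam i0 / mu i0) *: (mu i *: p i))).
    by rewrite sumrB -scaler_sumr mup scaler0 subr0.
  by move=> j _; rewrite scalerBl scalerA.
Qed.

End Caratheodory.

(** * Mixtures of automorphisms with a bounded number of terms *)

Section ConvAutSize.
Context {R : realType}.
Local Notation C := (R[i]).

Definition adcomb n l (lam : 'I_l -> R) (u : 'I_l -> 'M[C]_n) (x : 'M[C]_n) : 'M[C]_n :=
  \sum_i (lam i)%:C%C *: (adjmx (u i) *m x *m u i).

(** Fixing the number of terms lets the parameters range over one finite-dimensional space. *)
Definition convAut_size n l (Phi : 'M[C]_n -> 'M[C]_n) :=
  exists (lam : 'I_l -> R) (u : 'I_l -> 'M[C]_n),
    [/\ forall i, 0 <= lam i, \sum_i lam i = 1, forall i, unitary (u i) & Phi = adcomb lam u].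

Lemma convAut_size_pad n l (Phi : 'M[C]_n -> 'M[C]_n) :
  convAut_size l Phi -> convAut_size l.+1 Phi.
Proof.
case=> lam [u [lam0 lam1 uu ->]].
exists (fun i => oapp lam 0 (unlift ord_max i)), (fun i => oapp u 1%:M (unlift ord_max i)).
split=> [i||i|].
- by case: unliftP => [j|] _ /=.
- rewrite (bigD1_ord ord_max) //= unlift_none add0r -lam1.
  by apply: eq_bigr => i _; rewrite liftK.
- by case: unliftP => [j|] _ //=; apply: unitary1.
- apply/funext => x; rewrite /adcomb (bigD1_ord ord_max) //= unlift_none scale0r add0r.
  by apply: eq_bigr => i _; rewrite liftK.
Qed.

(* [bool] indexes the real and imaginary parts. *)
Definition mapcoord n : finType := ('I_n * 'I_n * 'I_n * 'I_n * bool)%type.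

Lemma convAut_size_reduce n l (Phi : 'M[C]_n -> 'M[C]_n) :
  (#|mapcoord n| < l)%N -> convAut_size l.+1 Phi -> convAut_size l Phi.
Proof.
move=> Dl [lam [u [lam0 lam1 uu ->]]].
(* The entries of [Ad(u_i)] on matrix units place it in a real space of dimension [2 n^4], where
   affine relations between points are relations between maps. *)
pose coord (c : mapcoord n) (i : 'I_l.+1) : R :=
  let: (j, k, r, s, b) := c in
  let z := (adjmx (u i) *m delta_mx j k *m u i) r s in
  if b then complex.Im z else complex.Re z.
have [lam' [i0 [lam'0 lam'1 lami0 sumE]]] :=
  caratheodory_step (fun i => \row_a coord (enum_val a) i) Dl lam0 lam1.
have coordE c : \sum_i lam' i * coord c i = \sum_i lam i * coord c i.
  have /rowP/(_ (enum_rank c)) := sumE; rewrite !summxE.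
  under eq_bigr do rewrite !mxE enum_rankK.
  by under [in RHS]eq_bigr do rewrite !mxE enum_rankK.
have adE : adcomb lam u = adcomb lam' u.
  have lin c : is_linear_map (adcomb c u) by apply: is_linear_comb => i; exact: is_linear_lr.
  apply/funext => x; rewrite (is_linear_delta _ (lin lam)) (is_linear_delta _ (lin lam')).
  apply: eq_bigr => j _; apply: eq_bigr => k _; congr (_ *: _).
  apply/matrixP => r s; rewrite !summxE.
  have ReIm (c : 'I_l.+1 -> R) (z : 'I_l.+1 -> C) : \sum_i (c i)%:C%C * z i =
      Complex (\sum_i c i * complex.Re (z i)) (\sum_i c i * complex.Im (z i)).
    apply/eqP; rewrite eq_complex /= !raddf_sum /=; apply/andP; split; apply/eqP/eq_bigr => i _;
      by case: (z i) => a b /=; rewrite mul0r ?subr0 ?addr0.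
  under eq_bigr do rewrite mxE; under [in RHS]eq_bigr do rewrite mxE.
  rewrite !ReIm; congr Complex.
    by rewrite -(coordE (j, k, r, s, false)).
  by rewrite -(coordE (j, k, r, s, true)).
rewrite adE; exists (fun i => lam' (lift i0 i)), (fun i => u (lift i0 i)); split=> //.
  by rewrite -lam'1 (bigD1_ord i0) //= lami0 add0r.
by apply/funext => x; rewrite /adcomb (bigD1_ord i0) //= lami0 scale0r add0r.
Qed.

(** The reduction works down to dimension plus one terms; shorter combinations are padded with
    weight 0. *)
Lemma convAut_bounded_size n (Phi : 'M[C]_n -> 'M[C]_n) :
  convAut Phi -> convAut_size #|mapcoord n|.+1 Phi.
Proof.
case=> l [lam [Ph [lam0 [lam1 [Ph_Aut PhiE]]]]].
have {PhiE} : convAut_size l Phi.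
  have [u uP] := choice Ph_Aut; exists lam, u; split=> //; first by move=> i; case: (uP i).
  by rewrite PhiE; apply/funext => x; apply: eq_bigr => i _; case: (uP i) => _ ->.
set D := #|_|.
have pad d m : convAut_size m Phi -> convAut_size (m + d) Phi.
  by elim: d => [|d IH] Phi_m; rewrite ?addn0 // addnS; apply/convAut_size_pad/IH.
have red d : convAut_size (D.+1 + d) Phi -> convAut_size D.+1 Phi.
  elim: d => [|d IH]; rewrite ?addn0 // addnS => /convAut_size_reduce Phi_d.
  by apply/IH/Phi_d; rewrite -/D addSn ltnS leq_addr.
have [lD|/ltnW Dl] := leqP l D.+1; first by rewrite -(subnKC lD); apply: pad.
by rewrite -{1}(subnKC Dl); apply: red.
Qed.

End ConvAutSize.

(** * Continuity of complex and matrix valued functions, by real coordinates *)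

Section ComplexContinuity.
Context {R : realType} {X : topologicalType}.
Local Notation C := (R[i]).

Definition ccontinuous (f : X -> C) :=
  continuous (fun x => complex.Re (f x)) /\ continuous (fun x => complex.Im (f x)).

Lemma ccontinuous_cst c : ccontinuous (fun=> c).
Proof. by split=> x; apply: cvg_cst. Qed.

Lemma ccontinuousD f g : ccontinuous f -> ccontinuous g -> ccontinuous (fun x => f x + g x).
Proof.
move=> [f1 f2] [g1 g2]; split=> x; under eq_fun do rewrite raddfD.
  by apply: cvgD; [exact: f1|exact: g1].
by apply: cvgD; [exact: f2|exact: g2].
Qed.

Lemma ccontinuousM f g : ccontinuous f -> ccontinuous g -> ccontinuous (fun x => f x * g x).
Proof.
have ReM (a b : C) : complex.Re (a * b) =
  complex.Re a * complex.Re b - complex.Im a * complex.Im b by case: a b => ? ? [].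
have ImM (a b : C) : complex.Im (a * b) =
  complex.Re a * complex.Im b + complex.Im a * complex.Re b.
  by case: a b => ? ? [? ?] /=; rewrite addrC.
move=> [f1 f2] [g1 g2]; split=> x.
  under eq_fun do rewrite ReM.
  by apply: cvgB; apply: cvgM; [exact: f1|exact: g1|exact: f2|exact: g2].
under eq_fun do rewrite ImM.
by apply: cvgD; apply: cvgM; [exact: f1|exact: g2|exact: f2|exact: g1].
Qed.

Lemma ccontinuous_conj f : ccontinuous f -> ccontinuous (fun x => conjc (f x)).
Proof.
move=> [f1 f2]; split=> x.
  rewrite (_ : (fun x => _) = (fun x => complex.Re (f x))); first exact: f1.
  by apply/funext => y; case: (f y).
rewrite (_ : (fun x => _) = (fun x => - complex.Im (f x))); first by apply: cvgN; exact: f2.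
by apply/funext => y; case: (f y).
Qed.

Lemma ccontinuous_sum (I : Type) (r : seq I) (f : I -> X -> C) :
  (forall i, ccontinuous (f i)) -> ccontinuous (fun x => \sum_(i <- r) f i x).
Proof.
move=> fc; elim: r => [|i r IH].
  by under eq_fun do rewrite big_nil; apply: ccontinuous_cst.
by under eq_fun do rewrite big_cons; apply: ccontinuousD.
Qed.

Definition mxcontinuous m n (f : X -> 'M[C]_(m, n)) :=
  forall i j, ccontinuous (fun x => f x i j).

Lemma mxcontinuousM m n p (f : X -> 'M[C]_(m, n)) (g : X -> 'M[C]_(n, p)) :
  mxcontinuous f -> mxcontinuous g -> mxcontinuous (fun x => f x *m g x).
Proof.
move=> fc gc i j; under eq_fun do rewrite mxE.
by apply: ccontinuous_sum => k; apply: ccontinuousM.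
Qed.

Lemma mxcontinuous_adj m n (f : X -> 'M[C]_(m, n)) :
  mxcontinuous f -> mxcontinuous (fun x => adjmx (f x)).
Proof. by move=> fc i j; under eq_fun do rewrite !mxE; apply: ccontinuous_conj. Qed.

Lemma mxcontinuous_cst m n (A : 'M[C]_(m, n)) : mxcontinuous (fun=> A).
Proof. by move=> i j; apply: ccontinuous_cst. Qed.

Lemma mxcontinuousB m n (f g : X -> 'M[C]_(m, n)) :
  mxcontinuous f -> mxcontinuous g -> mxcontinuous (fun x => f x - g x).
Proof.
move=> fc gc i j; under eq_fun do rewrite !mxE -mulN1r.
by apply: ccontinuousD => //; apply: ccontinuousM => //; apply: ccontinuous_cst.
Qed.

End ComplexContinuity.

(** * Compactness of the parameters and positivity of the distance *)

Section ConvAutClosed.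
Context {R : realType}.

Lemma continuous_sumr (X : topologicalType) (I : Type) (r : seq I) (f : I -> X -> R) :
  (forall i, continuous (f i)) -> continuous (fun x => \sum_(i <- r) f i x).
Proof.
move=> fc; elim: r => [|i r IH] x.
  by under eq_fun do rewrite big_nil; apply: cvg_cst.
by under eq_fun do rewrite big_cons; apply: cvgD; [exact: fc|exact: IH].
Qed.

Local Notation C := (R[i]).

(** The squared Frobenius norm: being polynomial in the real coordinates, it is continuous without
    any study of suprema. *)
Definition sqnorm m n (A : 'M[C]_(m, n)) : R :=
  \sum_i \sum_j (complex.Re (A i j) ^+ 2 + complex.Im (A i j) ^+ 2).

Lemma sqnorm_ge0 m n (A : 'M[C]_(m, n)) : 0 <= sqnorm A.
Proof. by apply: sumr_ge0 => i _; apply: sumr_ge0 => j _; rewrite addr_ge0 ?sqr_ge0. Qed.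

Lemma sqnorm_eq0 m n (A : 'M[C]_(m, n)) : sqnorm A = 0 -> A = 0.
Proof.
have s0 i j : 0 <= complex.Re (A i j) ^+ 2 + complex.Im (A i j) ^+ 2.
  by rewrite addr_ge0 ?sqr_ge0.
move=> /psumr_eq0P A0; apply/matrixP => i j; rewrite mxE.
have /psumr_eq0P/(_ j isT)/eqP := A0 (fun i _ => sumr_ge0 _ (fun j _ => s0 i j)) i isT.
move=> /(_ (fun j _ => s0 i j)); rewrite paddr_eq0 ?sqr_ge0 // !sqrf_eq0.
by case: (A i j) => a b /= /andP[/eqP-> /eqP->].
Qed.

Lemma sqnorm_continuous (X : topologicalType) m n (f : X -> 'M[C]_(m, n)) :
  mxcontinuous f -> continuous (fun x => sqnorm (f x) : R).
Proof.
move=> fc; apply: continuous_sumr => i; apply: continuous_sumr => j x.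
have [f1 f2] := fc i j.
by apply: cvgD; apply: cvgM; [exact: f1|exact: f1|exact: f2|exact: f2].
Qed.

Lemma closed_preimage_le (X : topologicalType) (f : X -> R) :
  continuous f -> closed [set x | 0 <= f x].
Proof. by move=> fc; apply: (preimage_closed (in1W fc) (closed_ge (y := 0))). Qed.

Lemma closed_preimage_eq (X : topologicalType) (f : X -> R) a :
  continuous f -> closed [set x | f x = a].
Proof. by move=> fc; apply: (preimage_closed (in1W fc) (closed_eq (y := a))). Qed.

(** The image of [K] is closed and misses 0, hence misses a ball around 0. Using its radius instead
    of a minimum covers an empty [K]. *)
Lemma compact_gt0_lower_bound (X : topologicalType) (K : set X) (f : X -> R) :
  compact K -> continuous f -> (forall x, K x -> 0 < f x) ->
  exists2 e, 0 < e & forall x, K x -> e <= f x.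
Proof.
move=> Kc fc f0.
have fK : closed (f @` K).
  apply: compact_closed; first exact: Rhausdorff.
  by apply: continuous_compact Kc; apply: continuous_subspaceT.
have : nbhs (0 : R) (~` (f @` K)).
  by apply: open_nbhs_nbhs; split; [exact: closed_openC|move=> [x /f0 +] f0E; rewrite f0E ltxx].
move=> /nbhs_ballP[e /= e0 He]; exists e => // x Kx; rewrite leNgt; apply/negP => fxe.
apply: (He (f x)); last by exists x.
by rewrite /ball /= sub0r normrN gtr0_norm ?f0.
Qed.

(* A pair [(lam, u)] of weights and of matrices is encoded by its list of real coordinates. *)
Definition adcoord n l : finType := ('I_l + 'I_l * 'I_n * 'I_n * bool)%type.

Definition weight n l (x : 'rV[R]_#|adcoord n l|) (i : 'I_l) : R :=
  x 0 (enum_rank (inl i : adcoord n l)).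

Definition factor n l (x : 'rV[R]_#|adcoord n l|) (i : 'I_l) : 'M[C]_n :=
  \matrix_(a, b) Complex (x 0 (enum_rank (inr (i, a, b, false) : adcoord n l)))
                         (x 0 (enum_rank (inr (i, a, b, true) : adcoord n l))).

Definition adset n l : set 'rV[R]_#|adcoord n l| :=
  [set x | [/\ forall i, 0 <= weight x i, \sum_i weight x i = 1 &
               forall i, factor x i *m adjmx (factor x i) = 1%:M]].

Lemma weight_continuous n l i : continuous (fun x : 'rV[R]_#|adcoord n l| => weight x i).
Proof. exact: coord_continuous. Qed.

Lemma factor_continuous n l i :
  mxcontinuous (fun x : 'rV[R]_#|adcoord n l| => factor x i).
Proof. by move=> a b; split; under eq_fun do rewrite mxE /=; exact: coord_continuous. Qed.

Lemma adcomb_continuous n l y :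
  mxcontinuous (fun x : 'rV[R]_#|adcoord n l| => adcomb (weight x) (factor x) y).
Proof.
move=> a b; rewrite /adcomb; under eq_fun do rewrite summxE.
apply: ccontinuous_sum => i; under eq_fun do rewrite mxE.
apply: ccontinuousM.
  by split=> /=; [exact: weight_continuous|exact: cst_continuous].
apply: mxcontinuousM; last exact: factor_continuous.
by apply: mxcontinuousM; [apply: mxcontinuous_adj; exact: factor_continuous|exact: mxcontinuous_cst].
Qed.

(** Closed, being cut out by real equations and inequalities, and inside a cube: weights summing to
    1 and entries of unitaries are bounded by 1. *)
Lemma adset_compact n l : compact (@adset n l).
Proof.
have box : compact [set x : 'rV[R]_#|adcoord n l| | forall i, `[-1, 1]%classic (x ord0 i)].
  exact: (@rV_compact R _ (fun=> `[-1, 1]%classic) (fun=> @segment_compact R _ _)).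
apply: (subclosed_compact _ box).
- have -> : @adset n l = \bigcap_i [set x | 0 <= weight x i] `&`
      [set x | \sum_i weight x i = 1] `&`
      \bigcap_i [set x | sqnorm (factor x i *m adjmx (factor x i) - 1%:M) = 0].
    apply/seteqP; split=> x.
      case=> x1 x2 x3; split; [by split=> // i _; exact: x1|move=> i _ /=].
      rewrite x3 subrr /sqnorm.
      by rewrite big1 // => j _; rewrite big1 // => k _; rewrite !mxE /= expr0n addr0.
    case=> -[x1 x2] x3; split=> // i; first exact: x1.
    by apply/eqP; rewrite -subr_eq0; apply/eqP/sqnorm_eq0/x3.
  apply: closedI; first apply: closedI.
  + by apply: closed_bigI => i _; apply: closed_preimage_le; exact: weight_continuous.
  + by apply: closed_preimage_eq; apply: continuous_sumr => i; exact: weight_continuous.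
  + apply: closed_bigI => i _; apply: closed_preimage_eq; apply: sqnorm_continuous.
    apply: mxcontinuousB; last exact: mxcontinuous_cst.
    by apply: mxcontinuousM; [|apply: mxcontinuous_adj]; exact: factor_continuous.
- move=> x [x1 x2 x3] c; rewrite -(enum_valK c); case: (enum_val c) => [i|[[[i a] b] t]].
    rewrite /= in_itv /=; apply/andP; split; first exact: le_trans (lerN10 _) (x1 i).
    rewrite -x2 /= (bigD1 i) //= -/(weight x i) lerDl; exact: sumr_ge0.
  have z1 : Num.sqrt (complex.Re (factor x i a b) ^+ 2 + complex.Im (factor x i a b) ^+ 2) <= 1.
    by apply: le_trans (entry_le_opnorm _ _ _) _; apply/opnorm_unitary/unitary_left.
  have {z1} : complex.Re (factor x i a b) ^+ 2 + complex.Im (factor x i a b) ^+ 2 <= 1.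
    by rewrite -(ler_sqrt _ ler01) sqrtr1.
  rewrite mxE /= in_itv /=; have := sqr_ge0 (x 0 (enum_rank (inr (i, a, b, t) : adcoord n l))).
  by case: t => /=; nra.
Qed.

Lemma entry_le_cbnorm n (T : 'M[C]_n -> 'M[C]_n) j k r s (z := T (delta_mx j k) r s) :
  is_linear_map T -> Num.sqrt (complex.Re z ^+ 2 + complex.Im z ^+ 2) <= cbnorm T.
Proof.
move=> T_lin; pose X : 'M[C]_(1 * n) := 1%:M *t delta_mx j k.
have X1 : opnorm X <= 1 := le_trans (opnorm_tens1 _ _) (opnorm_delta _ _).
have Xjk : blk X 0 0 = delta_mx j k.
  by apply/matrixP => a b; rewrite mxE tensmxE mxE eqxx mul1r.
apply: le_trans (cbnorm_ge T_lin X1).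
have := entry_le_opnorm (ampl 1 T X) (mxtens_index (0, r)) (mxtens_index (0, s)).
by have /matrixP/(_ r s) := blk_ampl X 0 0 T_lin; rewrite Xjk mxE => ->.
Qed.

(** The Frobenius quantity [dist] is continuous and positive on the compact parameter set, hence
    bounded below there, and it is dominated by a multiple of the squared cb-norm. *)
Lemma dcb_gt0 n (T : 'M[C]_n -> 'M[C]_n) : is_linear_map T -> ~ convAut T ->
  0 < dcb T (@convAut R n).
Proof.
move=> T_lin T_conv; pose L := #|mapcoord n|.+1.
pose Ad (x : 'rV[R]_#|adcoord n L|) := adcomb (weight x) (factor x).
pose dist x := \sum_j \sum_k sqnorm (T (delta_mx j k) - Ad x (delta_mx j k)).
have Ad_lin x : is_linear_map (Ad x) by apply: is_linear_comb => i; exact: is_linear_lr.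
have [e e0 He] : exists2 e, 0 < e & forall x, adset x -> e <= dist x.
  apply: compact_gt0_lower_bound; first exact: adset_compact.
    apply: continuous_sumr => j; apply: continuous_sumr => k; apply: sqnorm_continuous.
    by apply: mxcontinuousB; [exact: mxcontinuous_cst|exact: adcomb_continuous].
  move=> x [x1 x2 x3]; rewrite lt_def; apply/andP; split; last first.
    by apply: sumr_ge0 => j _; apply: sumr_ge0 => k _; exact: sqnorm_ge0.
  apply: contra_notN T_conv => /eqP/psumr_eq0P dist0.
  have -> : T = Ad x.
    apply/funext => y; rewrite (is_linear_delta y T_lin) (is_linear_delta y (Ad_lin x)).
    apply: eq_bigr => j _; apply: eq_bigr => k _; congr (_ *: _).
    apply/eqP; rewrite -subr_eq0; apply/eqP/sqnorm_eq0.
    have /psumr_eq0P := dist0 (fun j _ => sumr_ge0 _ (fun k _ => sqnorm_ge0 _)) j isT.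
    by apply=> // k' _; exact: sqnorm_ge0.
  by apply: convAut_finType => // i; apply/unitary_left/x3.
(* There are [n^2] matrix units with [n^2] entries each, all bounded by the cb-norm. *)
have dist_le x : dist x <= (n ^ 4)%:R * cbnorm (fun y => T y - Ad x y) ^+ 2.
  have D_lin := is_linear_sub T_lin (Ad_lin x).
  apply: (@le_trans _ _ (\sum_(j < n) \sum_(k < n) \sum_(r < n) \sum_(s < n)
      cbnorm (fun y => T y - Ad x y) ^+ 2)).
    do 4!apply: ler_sum => ? _; rewrite -(ler_sqrt _ (sqr_ge0 _)) sqrtr_sqr.
    rewrite ger0_norm ?cbnorm_ge0 //; exact: entry_le_cbnorm.
  by rewrite !sumr_const !card_ord -!mulrnA -[leLHS]mulr_natl !expnS expn0 muln1 !mulnA.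
(* The successor keeps the denominator positive when [n = 0]. *)
pose c := Num.sqrt (e / (n ^ 4).+1%:R).
have c0 : 0 < c by rewrite sqrtr_gt0 divr_gt0.
apply: lt_le_trans c0 _; apply: lb_le_inf.
  by exists (cbnorm (fun X => T X - X)), id => //; exact: convAut_id.
move=> _ [Phi /convAut_bounded_size[lam [u [lam0 lam1 uu ->]]] <-].
pose x : 'rV[R]_#|adcoord n L| := \row_c match enum_val c with
  | inl i => lam i
  | inr (i, a, b, false) => complex.Re (u i a b)
  | inr (i, a, b, true) => complex.Im (u i a b)
  end.
have xw : weight x = lam by apply/funext => i; rewrite /weight mxE enum_rankK.
have xf : factor x = u.
  apply/funext => i; apply/matrixP => a b; rewrite !mxE !enum_rankK.
  by case: (u i a b).
have Kx : adset x.
  by rewrite /adset /= xw xf; split=> // i; case: (uu i).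
have := le_trans (He _ Kx) (dist_le x); rewrite /Ad xw xf.
set d := cbnorm _; have d0 : 0 <= d.
  by apply/cbnorm_ge0/is_linear_sub => //; apply: is_linear_comb => i; exact: is_linear_lr.
move=> ed; rewrite -(ler_pXn2r (ltn0Sn 1)) ?nnegrE ?sqrtr_ge0 // sqr_sqrtr; last first.
  by rewrite divr_ge0 // ltW.
rewrite ler_pdivrMr // (le_trans ed) // mulrC ler_wpM2l ?sqr_ge0 // ler_nat.
exact: leqnSn.
Qed.

End ConvAutClosed.

(** * Tensor products, tensor powers and the conclusion *)

Section TensorPowers.
Context {R : realType}.
Local Notation C := (R[i]).

(** Stated for one fixed diagonal unit of [S], so that [S] can also be a tensor power of [T]. *)
Lemma dcb_tens n k (T : 'M[C]_n -> 'M[C]_n) (S : 'M[C]_k -> 'M[C]_k) p :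
  is_linear_map T -> T 1%:M = 1%:M -> S (delta_mx p p) = delta_mx p p ->
  dcb T (@convAut R n) / 2 <= dcb (tens T S) (@convAut R (n * k)).
Proof.
move=> T_lin T1 Sp; apply: lb_le_inf.
  by exists (cbnorm (fun X => tens T S X - X)), id => //; exact: convAut_id.
move=> _ [Phi Phi_conv <-].
have [Psi Psi_conv Psi_le] := convAut_compress T_lin T1 Sp Phi_conv.
rewrite ler_pdivrMr // mulrC; apply: le_trans Psi_le; apply: ge_inf; last by exists Psi.
exists 0 => _ [Phi' Phi'_conv <-]; apply/cbnorm_ge0/is_linear_sub => //.
exact: convAut_linear.
Qed.

Lemma delta_mx_tens m n (i j : 'I_m) (p q : 'I_n) :
  delta_mx (mxtens_index (i, p)) (mxtens_index (j, q)) =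
  delta_mx i j *t delta_mx p q :> 'M[C]_(m * n).
Proof.
apply/matrixP => a b; case: (mxtens_indexP a) => i' p'; case: (mxtens_indexP b) => j' q'.
by rewrite tensmxE !mxE !mxtens_index_eq -natrM mulnb andbACA.
Qed.

Lemma castmx_delta m n (e : m = n) i :
  castmx (e, e) (delta_mx i i) = delta_mx (cast_ord e i) (cast_ord e i) :> 'M[C]_n.
Proof. by case: n / e; rewrite castmx_id cast_ord_id. Qed.

Lemma dcb_castmx m n (e : m = n) (T : 'M[C]_n -> 'M[C]_n) :
  dcb (fun X => castmx (esym e, esym e) (T (castmx (e, e) X))) (@convAut R m) =
  dcb T (@convAut R n).
Proof. by case: n / e T. Qed.

Lemma UCPT_Schur_diag n (T : 'M[C]_n -> 'M[C]_n) i :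
  UCPT_Schur T -> T (delta_mx i i) = delta_mx i i.
Proof.
case=> -[_ T1 _ _] [b TE].
(* Unitality read on the diagonal. *)
have bii : b i i = 1.
  by have /matrixP/(_ i i) := T1; rewrite TE !mxE eqxx mulr1.
apply/matrixP => j k; rewrite TE !mxE.
by case: eqVneq => [->|_]; case: eqVneq => [->|_]; rewrite ?mulr0 // bii mulr1.
Qed.

Lemma tpow_diag n (T : 'M[C]_n -> 'M[C]_n) i k : is_linear_map T ->
  T (delta_mx i i) = delta_mx i i -> exists p, tpow T (k := k) (delta_mx p p) = delta_mx p p.
Proof.
move=> T_lin Ti; elim: k => [|k [p IH]]; first by exists ord0.
exists (cast_ord (esym (expnS n k)) (mxtens_index (i, p))) => /=.
rewrite castmx_delta cast_ordKV delta_mx_tens tens_deltar // Ti IH.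
by rewrite -delta_mx_tens castmx_delta.
Qed.

Lemma dcb_tpow n (T : 'M[C]_n -> 'M[C]_n) i k : is_linear_map T ->
  T 1%:M = 1%:M -> T (delta_mx i i) = delta_mx i i ->
  dcb T (@convAut R n) / 2 <= dcb (tpow T (k := k.+1)) (@convAut R (n ^ k.+1)).
Proof.
move=> T_lin T1 Ti; have [p Tp] := tpow_diag k T_lin Ti.
by rewrite /= dcb_castmx; exact: dcb_tens Tp.
Qed.

End TensorPowers.

Theorem theorem2p4 (R : realType) (n k : nat) (T : 'M[R[i]]_n -> 'M[R[i]]_n)
  (S : 'M[R[i]]_k -> 'M[R[i]]_k) :
  (0 < n)%N -> (0 < k)%N -> UCPT_Schur T -> UCPT_Schur S ->
  dcb (tens T S) (@convAut R (n * k)) >= dcb T (@convAut R n) / 2 /\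
  (~ convAut T -> ~ AQBP T).
Proof.
move=> n0 k0 T_schur S_schur; have [T_lin T1 _ _] := T_schur.1.
split; first exact: (dcb_tens T_lin T1 (UCPT_Schur_diag (Ordinal k0) S_schur)).
move=> /(dcb_gt0 T_lin) T_gt0 /cvgrPdist_lt/(_ _ (divr_gt0 T_gt0 (ltr0Sn _ 1)))[N _ AN].
(* [N.+1] guarantees a factor [T] to split off from the power, so the bound [dcb T / 2] applies to
   it. *)
have := AN N.+1 (leqnSn N); rewrite /= sub0r normrN ltNge.
apply/negP; rewrite negbK; apply: le_trans (ler_norm _).
exact: (dcb_tpow N T_lin T1 (UCPT_Schur_diag (Ordinal n0) T_schur)).
Qed.
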